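(* Let $\Gamma$ be a group generated by two elements. Let $R$ be a commutative ring such that $\mathrm{Pic}(\mathrm{Spec}(R))$ has no (nontrivial) $2$-torsion element. Then for each representation $\rho:\Gamma\to \mathrm{GL}_2(R)$ with Borel mold there exists $P\in \mathrm{GL}_2(R)$ such that $P\rho(\gamma)P^{-1}$ is upper triangular, i.e. $$P\rho(\gamma)P^{-1}=\begin{pmatrix} a(\gamma) & b(\gamma)\\ 0 & d(\gamma)\end{pmatrix}$$ for each $\gamma\in\Gamma$.
   Context: Let $X=\mathrm{Spec}(R)$. A mold of degree $n$ on $X$ is a subsheaf of $\mathcal{O}_X$-algebras (containing the identity matrix) $\mathcal{A}\subseteq \mathrm{M}_n(\mathcal{O}_X)$ such that $\mathcal{A}$ and $\mathrm{M}_n(\mathcal{O}_X)/\mathcal{A}$ are locally free sheaves. Two molds $\mathcal{A},\mathcal{B}$ of degree $n$ on $X$ are locally equivalent if every $x\in X$ has an open neighborhood $U$ and some $P_U\in \mathrm{GL}_n(\mathcal{O}_U)$ with $P_U^{-1}(\mathcal{A}|_U)P_U=\mathcal{B}|_U$. Let $\mathcal{B}_n\subset \mathrm{M}_n(\mathbb{Z})$ be the subalgebra of upper triangular matrices. A Borel mold of degree $n$ on $X$ is a mold locally equivalent to $\mathcal{B}_n\otimes_{\mathbb{Z}}\mathcal{O}_X$. A group homomorphism $\rho:\Gamma\to\mathrm{GL}_2(R)$ is a representation with Borel mold if the subsheaf of $\mathcal{O}_X$-algebras $\mathcal{O}_X[\rho(\Gamma)]\subseteq \mathrm{M}_2(\mathcal{O}_X)$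 generated by $\rho(\Gamma)$ is a Borel mold (of degree $2$). *)

(* Defs.v *)
From HB Require Import structures.
From mathcomp Require Import all_boot all_order all_algebra ring.
From mathcomp Require Import generic_quotient.
From mathcomp Require Import boolp classical_sets topology.

Set Implicit Arguments.
Unset Strict Implicit.
Unset Printing Implicit Defensive.

Import GRing.Theory.

Local Open Scope classical_set_scope.
Local Open Scope ring_scope.
Local Open Scope quotient_scope.

Record opens (X : topologicalType) :=
  Opens { oset : X -> Prop; oset_open : open oset }.
Coercion oset : opens >-> Funclass.

Definition whole (X : topologicalType) : opens X := Opens (@openT X).

Definition is_sheaf (X : topologicalType) (F : opens X -> Type)
    (res : forall U V : opens X, V `<=` U -> F U -> F V) : Prop :=
  [/\ forall (U : opens X) (h : U `<=` U) (s : F U), res U U h s = s,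
      forall (U V W : opens X) (hUV : V `<=` U) (hVW : W `<=` V)
        (hUW : W `<=` U) (s : F U),
        res V W hVW (res U V hUV s) = res U W hUW s
    & forall (U : opens X) (I : Type) (C : I -> opens X)
        (hC : forall i, C i `<=` U), U `<=` \bigcup_i (C i : set X) ->
      forall s : (forall i, F (C i)),
        (forall i j (W : opens X) (hi : W `<=` C i) (hj : W `<=` C j),
           res (C i) W hi (s i) = res (C j) W hj (s j)) ->
        exists! t : F U, forall i, res U (C i) (hC i) t = s i].

Record ringedSpace := RingedSpace {
  rspace :> topologicalType;
  rsec : opens rspace -> comPzRingType;
  rres : forall U V : opens rspace, V `<=` U -> {rmorphism rsec U -> rsec V};
  rsheaf : is_sheaf (F := rsec) (fun U V h => rres (U := U) (V := V) h)
}.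

Record modSheaf (X : ringedSpace) := ModSheaf {
  msec : forall U : opens X, lmodType (rsec U);
  mres : forall U V : opens X, V `<=` U -> msec U -> msec V;
  mresP : forall (U V : opens X) (h : V `<=` U) a (s t : msec U),
    mres h (a *: s + t) = rres h a *: mres h s + mres h t;
  msheaf : is_sheaf (F := msec) (fun U V h => mres (U := U) (V := V) h)
}.

Section FreeSheaf.
Variable X : ringedSpace.

Lemma mx_resP m n (U V : opens X) (h : V `<=` U) a (s t : 'M[rsec U]_(m, n)) :
  map_mx (rres h) (a *: s + t)
  = rres h a *: map_mx (rres h) s + map_mx (rres h) t.
Proof. by apply/matrixP=> i j; rewrite !mxE rmorphD rmorphM. Qed.

Lemma mx_is_sheaf m n :
  is_sheaf (F := fun U : opens X => 'M[rsec U]_(m, n))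
    (fun U V h => map_mx (rres (U := U) (V := V) h)).
Proof.
have [rid rcomp rglue] := rsheaf X; split.
- by move=> U h s; apply/matrixP=> i j; rewrite mxE rid.
- by move=> U V W h1 h2 h3 s; apply/matrixP=> i j; rewrite !mxE (rcomp _ _ _ _ _ h3).
move=> U I C hC cov s agree.
have ex i j : exists! t : rsec U, forall k, rres (hC k) t = s k i j.
  apply: rglue => // k l W hk hl.
  by have /matrixP/(_ i j) := agree k l W hk hl; rewrite !mxE.
have [t tP] := choice (fun ij => ex ij.1 ij.2).
exists (\matrix_(i, j) t (i, j)); split=> [k|t' t'P].
  by apply/matrixP=> i j; rewrite !mxE; have [-> _] := tP (i, j).
apply/matrixP=> i j; rewrite mxE; have [_ uniq_t] := tP (i, j).
by apply: uniq_t => k; rewrite -(t'P k) mxE.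
Qed.

Definition mxSheaf m n : modSheaf X :=
  ModSheaf (msec := fun U => 'M[rsec U]_(m, n)) (@mx_resP m n)
    (@mx_is_sheaf m n).

Lemma struct_resP (U V : opens X) (h : V `<=` U) a (s t : (rsec U)^o) :
  rres h (a *: s + t) = rres h a *: (rres h s : (rsec V)^o) + rres h t.
Proof. by rewrite rmorphD rmorphM. Qed.

Definition structSheaf : modSheaf X :=
  ModSheaf (msec := fun U => (rsec U)^o) struct_resP (rsheaf X).

End FreeSheaf.

Record modHom (X : ringedSpace) (F G : modSheaf X) := ModHom {
  mhom :> forall U : opens X, {linear msec F U -> msec G U};
  mhomP : forall (U V : opens X) (h : V `<=` U) (s : msec F U),
    mhom V (mres h s) = mres h (mhom U s)
}.

(* the restricted sheaf F|_W is represented by the modules F(U) with U in W *)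
Definition iso_on (X : ringedSpace) (W : opens X) (F G : modSheaf X) : Prop :=
  exists phi : (forall U : opens X, U `<=` W -> {linear msec F U -> msec G U}),
    (forall (U : opens X) (hU : U `<=` W), bijective (phi U hU)) /\
    (forall (U V : opens X) (hU : U `<=` W) (hV : V `<=` W) (h : V `<=` U)
       (s : msec F U), phi V hV (mres h s) = mres h (phi U hU s)).

Definition iso (X : ringedSpace) (F G : modSheaf X) : Prop :=
  iso_on (whole X) F G.

(* of finite rank, which may depend on the point *)
Definition locally_free (X : ringedSpace) (F : modSheaf X) : Prop :=
  forall x : X, exists U : opens X, U x /\
    exists r : nat, iso_on U (mxSheaf X 1 r) F.

Definition invertible_sheaf (X : ringedSpace) (L : modSheaf X) : Prop :=
  forall x : X, exists U : opens X, U x /\ iso_on U (structSheaf X) L.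

Definition mono (X : ringedSpace) (F G : modSheaf X) (phi : modHom F G) :=
  forall U : opens X, injective (phi U).

(* an epimorphism of sheaves is only locally onto *)
Definition epi (X : ringedSpace) (F G : modSheaf X) (phi : modHom F G) :=
  forall (U : opens X) (t : msec G U) (x : X), U x ->
    exists (V : opens X) (h : V `<=` U) (s : msec F V),
      V x /\ phi V s = mres h t.

Section Tensor.
Variable X : ringedSpace.

Record bilinHom (F G H : modSheaf X) := BilinHom {
  bhom :> forall U : opens X, msec F U -> msec G U -> msec H U;
  bhom_linl : forall U a (s s' : msec F U) (t : msec G U),
    bhom (a *: s + s') t = a *: bhom s t + bhom s' t;
  bhom_linr : forall U a (s : msec F U) (t t' : msec G U),
    bhom s (a *: t + t') = a *: bhom s t + bhom s t';
  bhom_res : forall (U V : opens X) (h : V `<=` U)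
    (s : msec F U) (t : msec G U),
    bhom (mres h s) (mres h t) = mres h (bhom s t)
}.

(* T, with the bilinear morphism b, is the tensor product of F and G over the
   structure sheaf: the universal property in the category of sheaves, so that
   no sheafification is needed *)
Definition tensor_via (F G T : modSheaf X) (b : bilinHom F G T) : Prop :=
  forall (H : modSheaf X) (c : bilinHom F G H),
    exists phi : modHom T H,
      (forall U (s : msec F U) (t : msec G U), phi U (b U s t) = c U s t) /\
      (forall psi : modHom T H,
         (forall U (s : msec F U) (t : msec G U), psi U (b U s t) = c U s t) ->
         forall U (z : msec T U), psi U z = phi U z).

Definition is_tensor (F G T : modSheaf X) : Prop :=
  exists b : bilinHom F G T, tensor_via b.

(* elements of Pic(X) are isomorphism classes of invertible sheaves, the
   product is the tensor product and the unit is the class of the structure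
   sheaf: [L]^2 = 1 implies [L] = 1 *)
Definition Pic_no_2torsion : Prop :=
  forall L : modSheaf X, invertible_sheaf L ->
    is_tensor L L (structSheaf X) -> iso L (structSheaf X).

End Tensor.

Section Molds.
Variables (X : ringedSpace) (n : nat).

(* closure under 0 and opposites follows from asecZ *)
Unset Implicit Arguments.
Record algSubsheaf := AlgSubsheaf {
  asec :> forall U : opens X, set 'M[rsec U]_n;
  asec1 : forall U, asec U 1%:M;
  asecD : forall U A B, asec U A -> asec U B -> asec U (A + B);
  asecZ : forall U a A, asec U A -> asec U (a *: A);
  asecM : forall U A B, asec U A -> asec U B -> asec U (A *m B);
  asec_res : forall (U V : opens X) (h : V `<=` U) A,
    asec U A -> asec V (map_mx (rres h) A);
  asec_loc : forall (U : opens X) (A : 'M[rsec U]_n),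
    (forall x, U x -> exists (V : opens X) (h : V `<=` U),
       V x /\ asec V (map_mx (rres h) A)) -> asec U A
}.
Set Implicit Arguments.

(* 0 -> F -> M_n(O_X) -> Q -> 0 is exact with F mapped onto A, so that F is A
   and Q is the quotient sheaf M_n(O_X)/A *)
Definition is_mold (A : algSubsheaf) : Prop :=
  exists (F Q : modSheaf X)
    (i : modHom F (mxSheaf X n n)) (q : modHom (mxSheaf X n n) Q),
    [/\ mono i /\ (forall U : opens X, range (i U) = A U),
        epi q /\ (forall U : opens X, [set M | q U M = 0] = A U),
        locally_free F
      & locally_free Q].

Definition in_GL (R : comPzRingType) m (P : 'M[R]_m) : Prop :=
  exists Q : 'M[R]_m, P *m Q = 1%:M /\ Q *m P = 1%:M.

Definition locally_equivalent (A B : algSubsheaf) : Prop :=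
  forall x : X, exists U : opens X, U x /\
    exists P Q : 'M[rsec U]_n,
      [/\ P *m Q = 1%:M, Q *m P = 1%:M
        & forall (V : opens X) (h : V `<=` U),
            [set map_mx (rres h) Q *m M *m map_mx (rres h) P | M in A V]
            = B V].

End Molds.

Definition upper_triangular (R : comPzRingType) n (M : 'M[R]_n) : Prop :=
  forall i j : 'I_n, (j < i)%N -> M i j = 0.

Section Borel.
Variables (X : ringedSpace) (n : nat).

Definition ut_sec (U : opens X) : set 'M[rsec U]_n :=
  [set M | upper_triangular M].
Arguments ut_sec : clear implicits.

Lemma ut1 U : ut_sec U 1%:M.
Proof. by move=> i j ji; rewrite mxE; case: eqP ji => // ->; rewrite ltnn. Qed.

Lemma utD U A B : ut_sec U A -> ut_sec U B -> ut_sec U (A + B).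
Proof. by move=> uA uB i j ji; rewrite mxE uA ?uB ?addr0. Qed.

Lemma utZ U a A : ut_sec U A -> ut_sec U (a *: A).
Proof. by move=> uA i j ji; rewrite mxE uA ?mulr0. Qed.

Lemma utM U A B : ut_sec U A -> ut_sec U B -> ut_sec U (A *m B).
Proof.
move=> uA uB i j ji; rewrite mxE big1 // => k _.
have [ki|ik] := ltnP k i; first by rewrite uA ?mul0r.
by rewrite uB ?mulr0 // (leq_trans ji).
Qed.

Lemma ut_res (U V : opens X) (h : V `<=` U) A :
  ut_sec U A -> ut_sec V (map_mx (rres h) A).
Proof. by move=> uA i j ji; rewrite mxE uA ?rmorph0. Qed.

Lemma ut_loc (U : opens X) (A : 'M[rsec U]_n) :
  (forall x, U x -> exists (V : opens X) (h : V `<=` U),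
     V x /\ ut_sec V (map_mx (rres h) A)) -> ut_sec U A.
Proof.
move=> locA i j ji; have [_ rcomp rglue] := rsheaf X.
have ex (x : {x : X | U x}) : exists V : {V : opens X | V `<=` U},
    sval V (sval x) /\ rres (svalP V) (A i j) = 0.
  have [V [h [Vx uV]]] := locA _ (svalP x).
  exists (exist _ V h); split=> //=.
  by have := uV _ _ ji; rewrite mxE => <-; congr (rres _ _); apply: Prop_irrelevance.
have [V VP] := choice ex.
have [|k l W hk hl|t [_ uniq_t]] := @rglue U _ (fun x => sval (V x))
  (fun x => svalP (V x)) _ (fun=> 0).
- by move=> x Ux; exists (exist _ x Ux) => //; case: (VP (exist _ x Ux)).
- by rewrite !rmorph0.
rewrite -(uniq_t 0) => [|x]; last by rewrite rmorph0.
by apply/esym/uniq_t=> x; case: (VP x).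
Qed.

(* B_n (x)_Z O_X: B_n is spanned over Z by the matrix units E_ij with i <= j,
   and so is its base change over O_X *)
Definition BorelSheaf : algSubsheaf X n :=
  AlgSubsheaf X n ut_sec ut1 utD utZ utM ut_res ut_loc.

Definition is_Borel_mold (A : algSubsheaf X n) : Prop :=
  is_mold A /\ locally_equivalent A BorelSheaf.

End Borel.

Section Generated.
Variables (X : ringedSpace) (n : nat) (S : set 'M[rsec (whole X)]_n).

Definition gen_sec (U : opens X) : set 'M[rsec U]_n :=
  [set M | forall A : algSubsheaf X n, S `<=` A (whole X) -> A U M].
Arguments gen_sec : clear implicits.

Lemma gen1 U : gen_sec U 1%:M.
Proof. by move=> A _; apply: asec1. Qed.

Lemma genD U M N : gen_sec U M -> gen_sec U N -> gen_sec U (M + N).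
Proof. by move=> gM gN A SA; apply: asecD; [apply: gM | apply: gN]. Qed.

Lemma genZ U a M : gen_sec U M -> gen_sec U (a *: M).
Proof. by move=> gM A SA; apply/asecZ/gM. Qed.

Lemma genM U M N : gen_sec U M -> gen_sec U N -> gen_sec U (M *m N).
Proof. by move=> gM gN A SA; apply: asecM; [apply: gM | apply: gN]. Qed.

Lemma gen_res (U V : opens X) (h : V `<=` U) M :
  gen_sec U M -> gen_sec V (map_mx (rres h) M).
Proof. by move=> gM A SA; apply/asec_res/gM. Qed.

Lemma gen_loc (U : opens X) (M : 'M[rsec U]_n) :
  (forall x, U x -> exists (V : opens X) (h : V `<=` U),
     V x /\ gen_sec V (map_mx (rres h) M)) -> gen_sec U M.
Proof.
move=> gM A SA; apply: asec_loc => x /gM[V [h [Vx gV]]].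
by exists V, h; split=> //; apply: gV.
Qed.

Definition generated : algSubsheaf X n :=
  AlgSubsheaf X n gen_sec gen1 genD genZ genM gen_res gen_loc.

End Generated.

Record spec (R : comPzRingType) := Spec {
  pideal : R -> bool;
  pideal0 : 0 \in pideal;
  pidealD : forall a b, a \in pideal -> b \in pideal -> a + b \in pideal;
  pidealM : forall a b, b \in pideal -> a * b \in pideal;
  pideal1 : 1 \notin pideal;
  pideal_prime : forall a b, a * b \in pideal -> (a \in pideal) || (b \in pideal)
}.

Coercion mem_spec (R : comPzRingType) (p : spec R) : {pred R} := pideal p.

HB.instance Definition _ (R : comPzRingType) := gen_eqMixin (spec R).
HB.instance Definition _ (R : comPzRingType) := gen_choiceMixin (spec R).

Section Zariski.
Variable R : comPzRingType.

(* the closed sets are the V(E) = {p | E is contained in p}, E a subset of R *)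
Definition zariski_open (U : set (spec R)) : Prop :=
  exists E : set R, U = ~` [set p | E `<=` [set a | a \in (p : spec R)]].

Lemma zariski_openE (U : set (spec R)) :
  zariski_open U <-> (forall p, U p -> exists2 f, f \notin p &
    forall q : spec R, f \notin q -> U q).
Proof.
split=> [[E ->] p /existsNP[f /not_implyP[Ef /negP fp]]|locU].
  exists f => // q fq Eq; exact: (negP fq (Eq _ Ef)).
exists [set f | forall q : spec R, f \notin q -> U q].
apply/seteqP; split=> [p Up Ep|p /existsNP[f /not_implyP[Ef /negP fp]]].
  by have [f fp fU] := locU p Up; move: fp; rewrite (Ep f fU).
exact: Ef.
Qed.

Lemma zariski_openT : zariski_open setT.
Proof. by apply/zariski_openE=> p _; exists 1; first exact: pideal1. Qed.

Lemma zariski_openI : setI_closed zariski_open.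
Proof.
move=> U V /zariski_openE oU /zariski_openE oV.
apply/zariski_openE=> p [/oU[f fp fU] /oV[g gp gV]].
exists (f * g).
  by apply/negP=> /pideal_prime/orP[]; apply/negP.
move=> q fgq; split; [apply: fU | apply: gV]; apply: contra fgq.
  by move=> fq; rewrite mulrC; apply: pidealM.
exact: pidealM.
Qed.

Lemma zariski_open_bigU (I : Type) (f : I -> set (spec R)) :
  (forall i, zariski_open (f i)) -> zariski_open (\bigcup_i f i).
Proof.
move=> of_; apply/zariski_openE=> p [i _ /((zariski_openE _).1 (of_ i))[g gp gU]].
by exists g => // q /gU; exists i.
Qed.

HB.instance Definition _ := isOpenTopological.Build (spec R)
  zariski_openT zariski_openI zariski_open_bigU.

End Zariski.

Section Localization.
Variables (R : comPzRingType) (p : spec R).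

Definition denom := {s : R | s \notin p}.

Lemma denom1P : 1 \notin p. Proof. exact: pideal1. Qed.

Lemma denomMP (s t : denom) : sval s * sval t \notin p.
Proof.
by apply/negP=> /pideal_prime/orP[]; apply/negP; [apply: (valP s)|apply: (valP t)].
Qed.

Definition denom1 : denom := exist _ 1 denom1P.
Definition denomM (s t : denom) : denom := exist _ (sval s * sval t) (denomMP s t).

Definition preloc := (R * denom)%type.

Definition loc_rel (x y : preloc) : bool :=
  `[< exists2 u, u \notin p & u * (x.1 * sval y.2) = u * (y.1 * sval x.2) >].

Lemma loc_rel_refl : reflexive loc_rel.
Proof. by move=> x; apply/asboolP; exists 1; first exact: pideal1. Qed.

Lemma loc_rel_sym : symmetric loc_rel.
Proof.
by move=> x y; apply/asboolP/asboolP=> -[u up e]; exists u.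
Qed.

Lemma loc_rel_trans : transitive loc_rel.
Proof.
move=> [b t] [a s] [c w] /asboolP[u up /= e1] /asboolP[v vp /= e2].
apply/asboolP; exists (sval (denomM (denomM (exist _ u up) (exist _ v vp)) t)).
  exact: denomMP.
rewrite /=.
transitivity (v * sval w * (u * (a * sval t))); first by ring.
rewrite e1; transitivity (u * sval s * (v * (b * sval w))); first by ring.
by rewrite e2; ring.
Qed.

Canonical loc_equiv := EquivRel loc_rel loc_rel_refl loc_rel_sym loc_rel_trans.

Definition loc := {eq_quot loc_rel}.

HB.instance Definition _ : EqQuotient _ loc_rel loc := EqQuotient.on loc.
HB.instance Definition _ := Choice.on loc.

Definition mkloc (a : R) (s : denom) : loc := \pi_loc (a, s).

Lemma mklocP a s b t :
  mkloc a s = mkloc b t <->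
  exists2 u, u \notin p & u * (a * sval t) = u * (b * sval s).
Proof.
split=> [/eqmodP/asboolP //|e].
by apply/eqmodP/asboolP.
Qed.

Lemma mkloc_surj (x : loc) : exists a s, x = mkloc a s.
Proof. by elim/quotW: x => -[a s]; exists a, s. Qed.

Definition addf (x y : preloc) : preloc :=
  (x.1 * sval y.2 + y.1 * sval x.2, denomM x.2 y.2).
Definition oppf (x : preloc) : preloc := (- x.1, x.2).
Definition mulf (x y : preloc) : preloc := (x.1 * y.1, denomM x.2 y.2).

Definition loc_add (x y : loc) : loc := \pi_loc (addf (repr x) (repr y)).
Definition loc_opp (x : loc) : loc := \pi_loc (oppf (repr x)).
Definition loc_mul (x y : loc) : loc := \pi_loc (mulf (repr x) (repr y)).
Definition loc0 : loc := mkloc 0 denom1.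
Definition loc1 : loc := mkloc 1 denom1.

Lemma repr_mkloc a s : exists b t, repr (mkloc a s) = (b, t) /\
  exists2 u, u \notin p & u * (a * sval t) = u * (b * sval s).
Proof.
case E: (repr (mkloc a s)) => [b t]; exists b, t; split=> //.
by apply/mklocP; rewrite /mkloc -E reprK.
Qed.

Lemma loc_addE a s b t :
  loc_add (mkloc a s) (mkloc b t)
  = mkloc (a * sval t + b * sval s) (denomM s t).
Proof.
have [a' [s' [E1 [u up e1]]]] := repr_mkloc a s.
have [b' [t' [E2 [v vp e2]]]] := repr_mkloc b t.
rewrite /loc_add E1 E2; apply/esym/mklocP.
exists (sval (denomM (exist _ u up) (exist _ v vp))); first exact: denomMP.
rewrite /=.
transitivity (v * (sval t * sval t') * (u * (a * sval s'))
  + u * (sval s * sval s') * (v * (b * sval t'))); first by ring.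
by rewrite e1 e2; ring.
Qed.

Lemma loc_mulE a s b t :
  loc_mul (mkloc a s) (mkloc b t) = mkloc (a * b) (denomM s t).
Proof.
have [a' [s' [E1 [u up e1]]]] := repr_mkloc a s.
have [b' [t' [E2 [v vp e2]]]] := repr_mkloc b t.
rewrite /loc_mul E1 E2; apply/esym/mklocP.
exists (sval (denomM (exist _ u up) (exist _ v vp))); first exact: denomMP.
rewrite /=.
transitivity ((u * (a * sval s')) * (v * (b * sval t'))); first by ring.
by rewrite e1 e2; ring.
Qed.

Lemma loc_oppE a s : loc_opp (mkloc a s) = mkloc (- a) s.
Proof.
have [a' [s' [E1 [u up e1]]]] := repr_mkloc a s.
rewrite /loc_opp E1; apply/esym/mklocP; exists u => //=.
by rewrite !mulNr !mulrN e1.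
Qed.

Lemma mkloc_eq a s b t : a * sval t = b * sval s -> mkloc a s = mkloc b t.
Proof.
by move=> e; apply/mklocP; exists 1; [exact: pideal1 | rewrite e].
Qed.

Lemma loc_addA : associative loc_add.
Proof.
move=> x y z; have [a [s ->]] := mkloc_surj x.
have [b [t ->]] := mkloc_surj y; have [c [u ->]] := mkloc_surj z.
by rewrite !loc_addE; apply: mkloc_eq => /=; ring.
Qed.

Lemma loc_addC : commutative loc_add.
Proof.
move=> x y; have [a [s ->]] := mkloc_surj x; have [b [t ->]] := mkloc_surj y.
by rewrite !loc_addE; apply: mkloc_eq => /=; ring.
Qed.

Lemma loc_add0 : left_id loc0 loc_add.
Proof.
move=> x; have [a [s ->]] := mkloc_surj x.
by rewrite loc_addE; apply: mkloc_eq => /=; ring.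
Qed.

Lemma loc_addN : left_inverse loc0 loc_opp loc_add.
Proof.
move=> x; have [a [s ->]] := mkloc_surj x.
by rewrite loc_oppE loc_addE; apply: mkloc_eq => /=; ring.
Qed.

HB.instance Definition _ :=
  GRing.isZmodule.Build loc loc_addA loc_addC loc_add0 loc_addN.

Lemma loc_mulA : associative loc_mul.
Proof.
move=> x y z; have [a [s ->]] := mkloc_surj x.
have [b [t ->]] := mkloc_surj y; have [c [u ->]] := mkloc_surj z.
by rewrite !loc_mulE; apply: mkloc_eq => /=; ring.
Qed.

Lemma loc_mulC : commutative loc_mul.
Proof.
move=> x y; have [a [s ->]] := mkloc_surj x; have [b [t ->]] := mkloc_surj y.
by rewrite !loc_mulE; apply: mkloc_eq => /=; ring.
Qed.

Lemma loc_mul1 : left_id loc1 loc_mul.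
Proof.
move=> x; have [a [s ->]] := mkloc_surj x.
by rewrite loc_mulE; apply: mkloc_eq => /=; ring.
Qed.

Lemma loc_mulD : left_distributive loc_mul loc_add.
Proof.
move=> x y z; have [a [s ->]] := mkloc_surj x.
have [b [t ->]] := mkloc_surj y; have [c [u ->]] := mkloc_surj z.
by rewrite !(loc_mulE, loc_addE); apply: mkloc_eq => /=; ring.
Qed.

HB.instance Definition _ := GRing.Zmodule_isComPzRing.Build loc
  loc_mulA loc_mulC loc_mul1 loc_mulD.

End Localization.

Section StructureSheaf.
Variable R : comPzRingType.
Implicit Types U V W : opens (spec R).

(* O_X(U) is the ring of functions p |-> s(p) in R_p on U which are locally of
   the form a / f with a, f in R *)
Definition regular U (s : forall p : spec R, U p -> loc p) : Prop :=
  forall p, U p -> exists (V : opens (spec R)) (a f : R),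
    [/\ V p, V `<=` U
      & forall q (Uq : U q), V q ->
          exists2 d : denom q, sval d = f & s q Uq = mkloc a d].

Record regsec U := Regsec {
  regval :> forall p : spec R, U p -> loc p;
  regvalP : regular regval
}.

Lemma regsecP U (s t : regsec U) :
  (forall p (Up : U p), s p Up = t p Up) -> s = t.
Proof.
case: s t => [s sP] [t tP] /= e.
have {}e : s = t by apply: functional_extensionality_dep => p;
  apply: functional_extensionality_dep.
by case: _ / e in tP *; congr Regsec; apply: Prop_irrelevance.
Qed.

HB.instance Definition _ U := gen_eqMixin (regsec U).
HB.instance Definition _ U := gen_choiceMixin (regsec U).

Definition opensI U V : opens (spec R) :=
  Opens (openI (oset_open U) (oset_open V)).

Lemma regular_cst U (a : R) :
  regular (U := U) (fun p _ => mkloc a (denom1 p)).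
Proof. by move=> p Up; exists U, a, 1; split=> // q Uq _; exists (denom1 q). Qed.

Lemma regular_add U (s t : regsec U) :
  regular (U := U) (fun p Up => s p Up + t p Up).
Proof.
move=> p Up; have [V [a [f [Vp VU sP]]]] := regvalP s Up.
have [W [b [g [Wp WU tP]]]] := regvalP t Up.
exists (opensI V W), (a * g + b * f), (f * g); split=> //.
  by move=> q [/VU].
move=> q Uq [Vq Wq]; have [d df ->] := sP q Uq Vq; have [e eg ->] := tP q Uq Wq.
by exists (denomM d e); rewrite -df -eg // [LHS]loc_addE.
Qed.

Lemma regular_mul U (s t : regsec U) :
  regular (U := U) (fun p Up => s p Up * t p Up).
Proof.
move=> p Up; have [V [a [f [Vp VU sP]]]] := regvalP s Up.
have [W [b [g [Wp WU tP]]]] := regvalP t Up.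
exists (opensI V W), (a * b), (f * g); split=> //.
  by move=> q [/VU].
move=> q Uq [Vq Wq]; have [d df ->] := sP q Uq Vq; have [e eg ->] := tP q Uq Wq.
by exists (denomM d e); rewrite -?df -?eg // [LHS]loc_mulE.
Qed.

Lemma regular_opp U (s : regsec U) : regular (U := U) (fun p Up => - s p Up).
Proof.
move=> p Up; have [V [a [f [Vp VU sP]]]] := regvalP s Up.
exists V, (- a), f; split=> // q Uq Vq; have [d df ->] := sP q Uq Vq.
by exists d => //; rewrite [LHS]loc_oppE.
Qed.

Section Ring.
Variable U : opens (spec R).

Definition reg_cst (a : R) : regsec U := Regsec (@regular_cst U a).
Definition reg_add (s t : regsec U) : regsec U := Regsec (regular_add s t).
Definition reg_mul (s t : regsec U) : regsec U := Regsec (regular_mul s t).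
Definition reg_opp (s : regsec U) : regsec U := Regsec (regular_opp s).

Lemma reg_addA : associative reg_add.
Proof. by move=> s t u; apply: regsecP => p Up /=; rewrite addrA. Qed.

Lemma reg_addC : commutative reg_add.
Proof. by move=> s t; apply: regsecP => p Up /=; rewrite addrC. Qed.

Lemma reg_add0 : left_id (reg_cst 0) reg_add.
Proof. by move=> s; apply: regsecP => p Up /=; rewrite [LHS]add0r. Qed.

Lemma reg_addN : left_inverse (reg_cst 0) reg_opp reg_add.
Proof. by move=> s; apply: regsecP => p Up /=; rewrite addNr. Qed.

HB.instance Definition _ :=
  GRing.isZmodule.Build (regsec U) reg_addA reg_addC reg_add0 reg_addN.

Lemma reg_mulA : associative reg_mul.
Proof. by move=> s t u; apply: regsecP => p Up /=; rewrite mulrA. Qed.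

Lemma reg_mulC : commutative reg_mul.
Proof. by move=> s t; apply: regsecP => p Up /=; rewrite mulrC. Qed.

Lemma reg_mul1 : left_id (reg_cst 1) reg_mul.
Proof. by move=> s; apply: regsecP => p Up /=; rewrite [LHS]mul1r. Qed.

Lemma reg_mulD : left_distributive reg_mul reg_add.
Proof. by move=> s t u; apply: regsecP => p Up /=; rewrite mulrDl. Qed.

HB.instance Definition _ := GRing.Zmodule_isComPzRing.Build (regsec U)
  reg_mulA reg_mulC reg_mul1 reg_mulD.

Lemma reg_cst_zmod : zmod_morphism reg_cst.
Proof.
move=> a b; apply: regsecP => p Up /=.
rewrite [- mkloc b _]loc_oppE [RHS]loc_addE.
by apply: mkloc_eq => /=; ring.
Qed.

Lemma reg_cst_monoid : monoid_morphism reg_cst.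
Proof.
split=> // a b; apply: regsecP => p Up /=; rewrite [RHS]loc_mulE.
by apply: mkloc_eq => /=; ring.
Qed.

HB.instance Definition _ := GRing.isZmodMorphism.Build R (regsec U) reg_cst
  reg_cst_zmod.
HB.instance Definition _ := GRing.isMonoidMorphism.Build R (regsec U) reg_cst
  reg_cst_monoid.

End Ring.

Section Restriction.
Variables (U V : opens (spec R)) (h : V `<=` U).

Lemma regular_res (s : regsec U) :
  regular (U := V) (fun p Vp => s p (h Vp)).
Proof.
move=> p Vp; have [W [a [f [Wp WU sP]]]] := regvalP s (h Vp).
exists (opensI W V), a, f; split=> // [q []//|q Vq [Wq _]].
exact: sP.
Qed.

Definition reg_res (s : regsec U) : regsec V := Regsec (regular_res s).

Lemma reg_res_zmod : zmod_morphism reg_res.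
Proof. by move=> s t; apply: regsecP. Qed.

Lemma reg_res_monoid : monoid_morphism reg_res.
Proof. by split=> [|s t]; apply: regsecP. Qed.

HB.instance Definition _ := GRing.isZmodMorphism.Build (regsec U) (regsec V)
  reg_res reg_res_zmod.
HB.instance Definition _ := GRing.isMonoidMorphism.Build (regsec U) (regsec V)
  reg_res reg_res_monoid.

End Restriction.

Lemma reg_is_sheaf :
  is_sheaf (F := fun U => regsec U) (fun U V h => reg_res (U := U) (V := V) h).
Proof.
have irr U (s : regsec U) p (h h' : U p) : s p h = s p h'.
  by congr (s p _); apply: Prop_irrelevance.
split=> [U h s|U V W h1 h2 h3 s|U I C hC cov s agree].
- by apply: regsecP => p Up /=; apply: irr.
- by apply: regsecP => p Up /=; apply: irr.
have agree' i j p (hi : C i p) (hj : C j p) : s i p hi = s j p hj.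
  have /(congr1 (fun t : regsec (opensI (C i) (C j)) => t p (conj hi hj))) :=
    agree i j (opensI (C i) (C j)) (@subIsetl _ _ _) (@subIsetr _ _ _).
  by rewrite /= (irr _ _ _ _ hi) (irr _ _ _ _ hj).
have ex p (Up : U p) : exists x : loc p, forall i (hi : C i p), s i p hi = x.
  by have [i _ hi] := cov p Up; exists (s i p hi) => j hj; apply: agree'.
pose t p (Up : U p) := sval (cid (ex p Up)).
have tE p (Up : U p) i (hi : C i p) : t p Up = s i p hi.
  by rewrite /t; case: cid => x /= ->.
have tP : regular t.
  move=> p Up; have [i _ hi] := cov p Up.
  have [V [a [f [Vp VC sP]]]] := regvalP (s i) hi.
  exists V, a, f; split=> // [q /VC/hC //|q Uq Vq].
  by rewrite (tE q Uq i (VC _ Vq)); apply: sP.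
exists (Regsec tP); split=> [i|t' t'P].
  by apply: regsecP => p hi /=; apply: tE.
apply: regsecP => p Up /=; have [i _ hi] := cov p Up.
by rewrite (tE _ _ _ hi) -(t'P i) /=; apply: irr.
Qed.

Definition SpecR : ringedSpace :=
  RingedSpace (rsec := fun U => regsec U)
    (rres := fun U V h => @reg_res U V h) reg_is_sheaf.

End StructureSheaf.

Section Representations.
Variables (Gamma : groupType) (R : comPzRingType) (n : nat).

(* rho(1) = 1 follows from the two conditions *)
Record representation := Representation {
  rep :> Gamma -> 'M[R]_n;
  rep_GL : forall g, in_GL (rep g);
  repM : forall g h, rep (g * h)%g = rep g *m rep h
}.

(* O_X[rho(Gamma)] on X = Spec R *)
Definition rep_mold (rho : representation) : algSubsheaf (SpecR R) n :=
  @generated (SpecR R) n [set M | exists g : Gamma,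
    M = map_mx (reg_cst (whole (spec R))) (rho g)].

Definition with_Borel_mold (rho : representation) : Prop :=
  is_Borel_mold (rep_mold rho).

End Representations.

Definition generated_by_two (Gamma : groupType) : Prop :=
  exists g h : Gamma, forall H : {pred Gamma},
    group_closed H -> g \in H -> h \in H -> forall x, x \in H.

(* Main.v *)
From HB Require Import structures.
Require Import Defs.
From mathcomp Require Import all_boot all_algebra.
From mathcomp Require Import ring.
From mathcomp Require Import boolp classical_sets topology.
Import GRing.Theory.
Local Open Scope ring_scope.

Set Implicit Arguments.
Unset Strict Implicit.
Unset Printing Implicit Defensive.

(** Let g, h generate Gamma and put N = [rho g, rho h].  Where the mold is
    conjugate to the upper triangular matrices, N becomes strictly upper
    triangular, so that N M N = 0 for every M in the mold.  Moreover
    N = [[a, b], [c, -a]] vanishes at no prime p: otherwise all of the mold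
    would be commutative modulo p, whereas upper triangular matrices are not.
    Hence (b, c) is the unit ideal, say r b + s c = 1, and L = ker N = im N is
    an invertible sheaf, stable under rho.  The symmetric form
      (N v', w) |-> det (v', w)
    identifies the tensor square of L with the structure sheaf, so that L is
    trivial by the assumption on Pic.  A generator of L over Spec R has its
    coordinates in R and is unimodular; it is the first vector of the basis
    sought. *)

(** * Primes and global sections of the structure sheaf *)

Local Open Scope classical_set_scope.

Section Primes.
Variable R : comPzRingType.
Implicit Types (I : set R) (f : R).

Definition is_ideal I : Prop :=
  [/\ I 0, forall a b, I a -> I b -> I (a + b)
    & forall a b, I b -> I (a * b)].

Lemma maximal_ideal_avoiding I f : is_ideal I -> (forall n, ~ I (f ^+ n)) ->
  exists J : set R, [/\ is_ideal J, I `<=` J, forall n, ~ J (f ^+ n)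
    & forall K, is_ideal K -> J `<=` K -> (forall n, ~ K (f ^+ n)) ->
        K `<=` J].
Proof.
move=> idI nI.
(* the empty set is admitted because the empty chain has an empty union *)
pose good := [set J : set R |
  J = set0 \/ [/\ is_ideal J, I `<=` J & forall n, ~ J (f ^+ n)]].
have [F Fgood Ftot|J [Jgood Jmax]] := @Zorn_bigcup R good.
  have good_of J a : F J -> J a ->
      [/\ is_ideal J, I `<=` J & forall n, ~ J (f ^+ n)].
    by move=> /Fgood [->|].
  have [->|/set0P[x [J0 FJ0 J0x]]] := eqVneq (\bigcup_(J in F) J) set0.
    by left.
  have [[J00 _ _] IJ0 _] := good_of _ _ FJ0 J0x.
  right; split=> [|a Ia|n [J FJ Jn]].
  - split=> [|a b [J FJ Ja] [K FK Kb]|a b [J FJ Jb]].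
    + by exists J0.
    + have [[_ DJ _] _ _] := good_of _ _ FJ Ja.
      have [[_ DK _] _ _] := good_of _ _ FK Kb.
      have [JK|KJ] := Ftot _ _ FJ FK.
        by exists K => //; apply: DK => //; apply: JK.
      by exists J => //; apply: DJ => //; apply: KJ.
    + have [[_ _ MJ] _ _] := good_of _ _ FJ Jb.
      by exists J => //; apply: MJ.
  - by exists J0 => //; apply: IJ0.
  - by have [_ _ /(_ n)] := good_of _ _ FJ Jn.
have Igood : good I by right; split.
(* The empty set is not maximal: [I], which contains 0, is strictly larger. *)
case: Jgood => [J0|[idJ IJ nJ]].
  case: (Jmax I) => //; rewrite J0; split=> // /(_ 0) I0.
  by apply: I0; case: idI.
exists J; split=> // K idK JK nK; apply: contrapT => nKJ.
by apply: (Jmax K); [split | right; split=> //; apply: subset_trans JK].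
Qed.

(** An ideal maximal among those missing every power of [f] is prime: if [a] and [b] lie outside it,
    adjoining either one captures a power of [f], and the product of these two powers falls into the
    ideal as soon as [a * b] does. *)
Lemma exists_prime_avoiding I f : is_ideal I -> (forall n, ~ I (f ^+ n)) ->
  exists p : spec R, (forall a, I a -> a \in p) /\ f \notin p.
Proof.
move=> idI /(maximal_ideal_avoiding idI)[J [[J0 JD JM] IJ nJ Jmax]].
have meet a : ~ J a -> exists n j x, J j /\ f ^+ n = j + x * a.
  move=> nJa; apply: contrapT => no.
  pose K := [set z | exists j x, J j /\ z = j + x * a].
  apply: nJa; apply: (Jmax K).
  - split=> [|_ _ [j [x [Jj ->]]] [k [y [Jk ->]]]|b _ [j [x [Jj ->]]]].
    + by exists 0, 0; rewrite mul0r addr0.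
    + by exists (j + k), (x + y); split; [exact: JD | ring].
    + by exists (b * j), (b * x); split; [exact: JM | ring].
  - by move=> j Jj; exists j, 0; rewrite mul0r addr0.
  - by move=> n [j [x [Jj e]]]; apply: no; exists n, j, x.
  - by exists 0, 1; rewrite mul1r add0r.
pose m := fun a => `[< J a >].
have m0 : 0 \in m by apply/asboolP.
have mD a b : a \in m -> b \in m -> a + b \in m.
  by move=> /asboolP Ja /asboolP Jb; apply/asboolP/JD.
have mM a b : b \in m -> a * b \in m.
  by move=> /asboolP Jb; apply/asboolP/JM.
have m1 : 1 \notin m.
  by apply/asboolP; rewrite -(expr0 f); apply: nJ.
have mP a b : a * b \in m -> (a \in m) || (b \in m).
  move=> /asboolP Jab; apply: contraT => /norP[/asboolP nJa /asboolP nJb].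
  have [n [j [x [Jj en]]]] := meet a nJa.
  have [k [l [y [Jl ek]]]] := meet b nJb.
  case: (nJ (n + k)%N); rewrite exprD en ek.
  have -> : (j + x * a) * (l + y * b)
    = (l + y * b) * j + (x * a * l + (x * y) * (a * b)) by ring.
  by apply: (JD); [apply: (JM) | apply: (JD); apply: (JM)].
exists (Spec m0 mD mM m1 mP); split=> [a Ia|].
  by apply/asboolP/IJ.
by apply/asboolP; rewrite -(expr1 f); apply: nJ.
Qed.

(** Contrapositive of the existence of primes. It plays the role of quasi-compactness: the
    hypothesis covers the locus where [f] does not vanish by loci of elements of [I]. *)
Lemma ideal_power I f : is_ideal I ->
  (forall p : spec R, f \notin p -> exists2 a, I a & a \notin p) ->
  exists n, I (f ^+ n).
Proof.
move=> idI cov; apply: contrapT => /forallNP/(exists_prime_avoiding idI)[p [Ip fp]].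
by have [a /Ip ->] := cov p fp.
Qed.

Lemma ideal_full I : is_ideal I ->
  (forall p : spec R, exists2 a, I a & a \notin p) -> I 1.
Proof.
move=> idI cov; have [|n] := @ideal_power I 1 idI; first by move=> p _.
by rewrite expr1n.
Qed.

Lemma ideal_ann (a : R) : is_ideal [set u | u * a = 0].
Proof.
split=> [|u v /= ua va|u v /= va]; first by rewrite /= mul0r.
  by rewrite mulrDl ua va addr0.
by rewrite -mulrA va mulr0.
Qed.

Lemma ideal_principal (a : R) : is_ideal [set u | exists x, u = x * a].
Proof.
split=> [|_ _ [x ->] [y ->]|u _ [x ->]]; first by exists 0; rewrite mul0r.
  by exists (x + y); rewrite mulrDl.
by exists (u * x); rewrite mulrA.
Qed.

Lemma ideal_pair (a b : R) : is_ideal [set u | exists x y, u = x * a + y * b].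
Proof.
split=> [|_ _ [x [y ->]] [z [t ->]]|u _ [x [y ->]]].
- by exists 0, 0; rewrite !mul0r addr0.
- by exists (x + z), (y + t); ring.
- by exists (u * x), (u * y); ring.
Qed.

End Primes.

Section Germs.
Variable R : comPzRingType.
Implicit Types (p : spec R) (U V : opens (spec R)).

Definition loc_cst p (a : R) : loc p := mkloc a (denom1 p).

Lemma loc_cst_eq0 p a : loc_cst p a = 0 <-> exists2 u, u \notin p & u * a = 0.
Proof.
split=> [/mklocP[u up]|[u up ua]].
  by rewrite /= mul0r mulr0 mulr1; exists u.
by apply/mklocP; exists u => //=; rewrite mul0r mulr0 mulr1.
Qed.

Fact loc_cst_zmod p : zmod_morphism (loc_cst p).
Proof.
move=> a b; rewrite [- loc_cst p b]loc_oppE [RHS]loc_addE.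
by apply: mkloc_eq => /=; ring.
Qed.

Fact loc_cst_monoid p : monoid_morphism (loc_cst p).
Proof.
by split=> // a b; rewrite [RHS]loc_mulE; apply: mkloc_eq => /=; ring.
Qed.

HB.instance Definition _ p := GRing.isZmodMorphism.Build R (loc p) (loc_cst p)
  (loc_cst_zmod p).
HB.instance Definition _ p := GRing.isMonoidMorphism.Build R (loc p) (loc_cst p)
  (loc_cst_monoid p).

(** Trades a fraction for an equation between images of elements of [R], to which the morphism laws
    of [loc_cst] apply. *)
Lemma mkloc_cst p a (d : denom p) x :
  x = mkloc a d <-> loc_cst p (sval d) * x = loc_cst p a.
Proof.
have e : loc_cst p (sval d) * mkloc 1 d = 1.
  by rewrite [LHS]loc_mulE; apply: mkloc_eq => /=; ring.
have -> : mkloc a d = loc_cst p a * mkloc 1 d.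
  by rewrite [RHS]loc_mulE; apply: mkloc_eq => /=; ring.
split=> [->|<-]; first by rewrite mulrCA e mulr1.
by rewrite mulrAC e mul1r.
Qed.

Lemma loc_cst_cancel p f (x y : loc p) : f \notin p ->
  loc_cst p f * x = loc_cst p f * y -> x = y.
Proof.
move=> fp /(congr1 ( *%R (mkloc 1 (exist _ f fp)))).
have e : mkloc 1 (exist _ f fp) * loc_cst p f = 1.
  by rewrite [LHS]loc_mulE; apply: mkloc_eq => /=; ring.
by rewrite !mulrA e !mul1r.
Qed.

(** The annihilator of [a] is contained in no prime, hence contains 1. *)
Lemma loc_cst_inj (a : R) : (forall p : spec R, loc_cst p a = 0) -> a = 0.
Proof.
move=> a0; rewrite -[a]mul1r; apply: (ideal_full (ideal_ann a)) => p.
by have /loc_cst_eq0[u up ua] := a0 p; exists u.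
Qed.

Definition germ U p (Up : U p) (s : regsec U) : loc p := s p Up.

Fact germ_zmod U p (Up : U p) : zmod_morphism (germ Up).
Proof. by []. Qed.

Fact germ_monoid U p (Up : U p) : monoid_morphism (germ Up).
Proof. by []. Qed.

HB.instance Definition _ U p (Up : U p) :=
  GRing.isZmodMorphism.Build (regsec U) (loc p) (germ Up) (germ_zmod Up).
HB.instance Definition _ U p (Up : U p) :=
  GRing.isMonoidMorphism.Build (regsec U) (loc p) (germ Up) (germ_monoid Up).

Lemma germ_cst U p (Up : U p) a : germ Up (reg_cst U a) = loc_cst p a.
Proof. by []. Qed.

Lemma reg_cst_inj : injective (reg_cst (whole (spec R))).
Proof.
move=> a b e; apply/eqP; rewrite -subr_eq0; apply/eqP/loc_cst_inj => p.
by rewrite rmorphB /= -!(@germ_cst (whole _) p I) e subrr.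
Qed.

Definition basic_open (f : R) : opens (spec R).
refine (@Opens (spec R) (fun p => f \notin p) _).
by apply/zariski_openE => p fp; exists f.
Defined.

Lemma basic_open_nbhs U p : U p ->
  exists2 f, f \notin p & forall q : spec R, f \notin q -> U q.
Proof. exact: (zariski_openE _).1 (oset_open U) p. Qed.

Lemma basic_open_unit f : exists s : regsec (basic_open f),
  s * reg_cst (basic_open f) f = 1.
Proof.
have reg : regular (U := basic_open f)
    (fun p fp => mkloc 1 (exist _ f fp : denom p)).
  by move=> p fp; exists (basic_open f), 1, f; split=> // q fq _;
    exists (exist _ f fq).
exists (Regsec reg); apply: regsecP => p fp /=.
by rewrite [LHS]loc_mulE; apply: mkloc_eq => /=; ring.
Qed.

(** The denominator [k] may differ from [g], which spares passing to powers of [g]. Gluing then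
    amounts to showing that these [g] form an ideal and that it contains 1. *)
Definition fraction_on (s : regsec (whole (spec R))) (g : R) : Prop :=
  exists a k, forall q : spec R, g \notin q ->
    k \notin q /\ loc_cst q k * s q I = loc_cst q a.

Lemma ideal_fraction_on s : is_ideal (fraction_on s).
Proof.
have notinM (p : spec R) x y : x \notin p -> y \notin p -> x * y \notin p.
  by move=> xp yp; apply/negP => /pideal_prime/orP[]; apply/negP.
have notinX (p : spec R) x n : x \notin p -> x ^+ n \notin p.
  move=> xp; elim: n => [|n IH]; first exact: pideal1.
  by rewrite exprS; apply: notinM.
split.
- by exists 0, 0 => q; rewrite pideal0.
- move=> g1 g2 [a1 [k1 e1]] [a2 [k2 e2]].
  (* The two fractions agree where [g1 * g2] does not vanish, so a power of it kills their cross
     difference. Expanding both fractions by [g1 ^+ N] and [g2 ^+ N] turns this into the exact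
     relation [l1 * b2 = l2 * b1]. *)
  have [N eN] : exists N, (g1 * g2) ^+ N * (k1 * a2 - k2 * a1) = 0.
    apply: (ideal_power (ideal_ann _)) => q gq.
    have g1q : g1 \notin q by apply: contra gq; rewrite mulrC; apply: pidealM.
    have g2q : g2 \notin q by apply: contra gq; apply: pidealM.
    have [_ E1] := e1 q g1q; have [_ E2] := e2 q g2q.
    have /loc_cst_eq0[u up ue] : loc_cst q (k1 * a2 - k2 * a1) = 0.
      by rewrite rmorphB !rmorphM /= -E1 -E2; ring.
    by exists u.
  pose l1 := g1 ^+ N * k1; pose l2 := g2 ^+ N * k2.
  pose b1 := g1 ^+ N * a1; pose b2 := g2 ^+ N * a2.
  have e : l1 * b2 = l2 * b1.
    by apply/eqP; rewrite -subr_eq0 -eN exprMn /l1 /l2 /b1 /b2; apply/eqP; ring.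
  have E1 (q : spec R) : g1 \notin q -> l1 \notin q /\ loc_cst q l1 * s q I = loc_cst q b1.
    move=> gq; have [kq E] := e1 q gq; split; first by apply/notinM/kq/notinX.
    by rewrite !rmorphM /= -mulrA E.
  have E2 (q : spec R) : g2 \notin q -> l2 \notin q /\ loc_cst q l2 * s q I = loc_cst q b2.
    move=> gq; have [kq E] := e2 q gq; split; first by apply/notinM/kq/notinX.
    by rewrite !rmorphM /= -mulrA E.
  have split_notin (q : spec R) : g1 + g2 \notin q -> g1 \notin q \/ g2 \notin q.
    move=> gq; apply/orP; rewrite -negb_and; apply: contra gq => /andP[].
    exact: pidealD.
  (* Partition of unity: where [g1 + g2] does not vanish, [l1] or [l2] does not either. The same
     combination of [b1] and [b2] is the numerator sought, as is seen after multiplying by the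
     nonvanishing [l1] or [l2]. *)
  have [M [c1 [c2 eM]]] : exists M, exists c1 c2,
      (g1 + g2) ^+ M = c1 * l1 + c2 * l2.
    apply: (ideal_power (ideal_pair _ _)) => q /split_notin[/E1|/E2] [lq _].
      by exists l1 => //; exists 1, 0; ring.
    by exists l2 => //; exists 0, 1; ring.
  exists (c1 * b1 + c2 * b2), ((g1 + g2) ^+ M) => q gq.
  split; first exact: notinX.
  case: (split_notin q gq) => [/E1|/E2] [lq E]; apply: (loc_cst_cancel lq).
  + by rewrite mulrCA E -!rmorphM eM; congr (loc_cst q _); ring: e.
  + by rewrite mulrCA E -!rmorphM eM; congr (loc_cst q _); ring: e.
- move=> b g [a [k e]]; exists a, k => q bgq; apply: e.
  by apply: contra bgq; apply: pidealM.
Qed.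

Lemma reg_cst_surj (s : regsec (whole (spec R))) :
  exists a, s = reg_cst (whole (spec R)) a.
Proof.
have [a [k e]] : fraction_on s 1.
  apply: (ideal_full (ideal_fraction_on s)) => p.
  have [V [a [f [Vp _ sP]]]] := regvalP s (I : whole (spec R) p).
  have [g gp gV] := basic_open_nbhs Vp; exists g => //.
  exists a, f => q /gV Vq; have [d df ->] := sP q I Vq.
  by rewrite -df; split; [exact: (svalP d) | exact: (mkloc_cst a d _).1].
(* The denominator lies in no prime, so it is a unit and the fraction is an element of [R]. *)
have [u ku] : exists u, 1 = u * k.
  apply: (ideal_full (ideal_principal k)) => p.
  by have [kp _] := e p (pideal1 p); exists k => //; exists 1; rewrite mul1r.
exists (u * a); apply: regsecP => p []; have [_ E] := e p (pideal1 p).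
rewrite -[RHS]/(loc_cst p (u * a)) rmorphM /= -E mulrA -rmorphM -ku rmorph1.
by rewrite mul1r.
Qed.

End Germs.

(** * Kernel sheaves and invertible sheaves *)

Section GlobalRestriction.
Variable X : ringedSpace.
Implicit Types U V : opens X.

Lemma sub_whole U : U `<=` whole X. Proof. by []. Qed.

Definition gres U : {rmorphism rsec (whole X) -> rsec U} :=
  rres (@sub_whole U).

Lemma gresE U V (h : V `<=` U) a : rres h (gres U a) = gres V a.
Proof. by have [_ rcomp _] := rsheaf X; apply: rcomp. Qed.

Lemma map_gresE p q U V (h : V `<=` U) (M : 'M_(p, q)) :
  map_mx (rres h) (map_mx (gres U) M) = map_mx (gres V) M.
Proof. by apply/matrixP => i j; rewrite !mxE gresE. Qed.

Lemma gres_whole a : gres (whole X) a = a.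
Proof. by have [rid _ _] := rsheaf X; apply: rid. Qed.

Lemma map_gres_whole p q (M : 'M_(p, q)) : map_mx (gres (whole X)) M = M.
Proof. by apply/matrixP => i j; rewrite !mxE gres_whole. Qed.

End GlobalRestriction.

Section KernelSheaf.
Variables (X : ringedSpace) (m n : nat) (N : 'M[rsec (whole X)]_(m, n)).
Implicit Types U V W : opens X.

Definition in_kernel U : {pred 'cV[rsec U]_n} :=
  fun v => map_mx (gres U) N *m v == 0.

Fact in_kernel_submod U : submod_closed (@in_kernel U).
Proof.
split=> [|a u v]; first by rewrite unfold_in mulmx0.
rewrite !unfold_in => /eqP Nu /eqP Nv.
by rewrite mulmxDr -scalemxAr Nu Nv scaler0 addr0.
Qed.

HB.instance Definition _ U :=
  GRing.isSubmodClosed.Build _ _ (@in_kernel U) (in_kernel_submod U).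

Record kersec U := Kersec {
  kerval :> 'cV[rsec U]_n;
  kervalP : kerval \in @in_kernel U
}.

HB.instance Definition _ U := [isSub for @kerval U].
HB.instance Definition _ U := [Choice of kersec U by <:].
HB.instance Definition _ U := [SubChoice_isSubLmodule of kersec U by <:].

Lemma kersec_eq U (v : kersec U) : map_mx (gres U) N *m v = 0.
Proof. by apply/eqP; case: v. Qed.

Fact kerres_subproof U V (h : V `<=` U) (v : kersec U) :
  map_mx (rres h) v \in @in_kernel V.
Proof. by rewrite unfold_in -(map_gresE h) -map_mxM kersec_eq map_mx0. Qed.

Definition kerres U V (h : V `<=` U) (v : kersec U) : kersec V :=
  Kersec (kerres_subproof h v).

Fact kerresP U V (h : V `<=` U) a (s t : kersec U) :
  kerres h (a *: s + t) = rres h a *: kerres h s + kerres h t.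
Proof. by apply: val_inj; rewrite /= mx_resP. Qed.

Fact ker_is_sheaf :
  is_sheaf (F := kersec) (fun U V h => kerres (U := U) (V := V) h).
Proof.
have [rid rcomp rglue] := mx_is_sheaf X n 1.
split=> [U h s|U V W h1 h2 h3 s|U I C hC cov s agree].
- by apply: val_inj; rewrite /= rid.
- by apply: val_inj; rewrite /= (rcomp _ _ _ _ _ h3).
have [|t [tP t_uniq]] := rglue U I C hC cov (fun i => s i).
  by move=> i j W hi hj; have /(congr1 val) := agree i j W hi hj.
(* The glued column lies in the kernel because its image under [N] and 0 both glue the zero
   sections, and gluing is unique. *)
have [_ _ zglue] := mx_is_sheaf X m 1.
have [|z [_ z_uniq]] := zglue U I C hC cov (fun i => 0).
  by move=> i j W hi hj; rewrite /= !map_mx0.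
have tK : t \in @in_kernel U.
  have z0 : z = 0 by apply: z_uniq => i /=; rewrite map_mx0.
  rewrite unfold_in -[X in _ == X]z0 eq_sym; apply/eqP/z_uniq => i /=.
  by rewrite map_mxM map_gresE tP kersec_eq.
exists (Kersec tK); split=> [i|t' t'P]; apply: val_inj => /=; first exact: tP.
by apply: t_uniq => i; rewrite -t'P.
Qed.

Definition kerSheaf : modSheaf X :=
  ModSheaf (msec := fun U => kersec U) kerresP ker_is_sheaf.

End KernelSheaf.

Section SheafOfRankOne.
Variables (X : ringedSpace) (F : modSheaf X).
Implicit Types U V W : opens X.

Lemma mres_comp U V W (h1 : V `<=` U) (h2 : W `<=` V) (h3 : W `<=` U)
  (s : msec F U) : mres h2 (mres h1 s) = mres h3 s.
Proof. by have [_ rcomp _] := msheaf F; apply: rcomp. Qed.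

Lemma mresZ U V (h : V `<=` U) a (s : msec F U) :
  mres h (a *: s) = rres h a *: mres h s.
Proof.
have res0 : mres h (0 : msec F U) = 0.
  have /(congr1 (fun t => t - mres h 0)) := mresP h 1 (0 : msec F U) 0.
  by rewrite scaler0 addr0 rmorph1 scale1r addrK subrr.
by rewrite -[a *: s]addr0 mresP res0 addr0.
Qed.

Lemma mresD U V (h : V `<=` U) (s t : msec F U) :
  mres h (s + t) = mres h s + mres h t.
Proof. by rewrite -[s]scale1r mresP rmorph1 !scale1r. Qed.

Definition scale_section U (x : msec F U) (f : (rsec U)^o) : msec F U := f *: x.

Fact scale_section_linear U (x : msec F U) : linear (scale_section x).
Proof. by move=> a f g; rewrite /scale_section scalerDl scalerA. Qed.

HB.instance Definition _ U (x : msec F U) :=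
  GRing.isLinear.Build (rsec U) (rsec U)^o (msec F U) *:%R (scale_section x)
    (scale_section_linear x).

Lemma iso_on_generator U (x : msec F U) :
  (forall V (h : V `<=` U) (v : msec F V),
     exists! f : rsec V, v = f *: mres h x) ->
  iso_on U (structSheaf X) F.
Proof.
move=> gen; exists (fun V hV => scale_section (mres hV x) : {linear _ -> _}).
split=> [V hV|V W hV hW h f] /=.
  have [g gP] := choice (gen V hV).
  exists g => [f|v]; rewrite /scale_section.
    by have [_] := gP (f *: mres hV x); apply.
  by have [<-] := gP v.
by rewrite /scale_section mresZ (mres_comp _ _ hW).
Qed.

Lemma iso_structSheaf_generator : iso F (structSheaf X) ->
  exists x : msec F (whole X), forall v, exists f, v = f *: x.
Proof.
move=> [phi [bij _]]; have {}bij := bij (whole X) (fun _ => id).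
have [psi phiK psiK] := bij.
exists (psi 1) => v; exists (phi _ (fun _ => id) v); apply: (can_inj phiK).
by rewrite linearZ psiK /= [RHS]mulr1.
Qed.

Definition scale_hom (z : msec F (whole X)) : modHom (structSheaf X) F.
refine (@ModHom X (structSheaf X) F
  (fun U => scale_section (mres (@sub_whole X U) z) : {linear _ -> _}) _).
by move=> U V h f; rewrite /= /scale_section mresZ (mres_comp _ _ (@sub_whole X V)).
Defined.

Lemma scale_homE z U f : scale_hom z U f = f *: mres (@sub_whole X U) z.
Proof. by []. Qed.

End SheafOfRankOne.

Section Bilin.
Variables (X : ringedSpace) (F G H : modSheaf X) (b : bilinHom F G H).
Variable U : opens X.
Implicit Types (s : msec F U) (t : msec G U).

Lemma bhom0l t : b U 0 t = 0.
Proof.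
have := bhom_linl b 1 (0 : msec F U) 0 t; rewrite scaler0 addr0 scale1r.
by move/(congr1 (fun z => z - b U 0 t)); rewrite addrK subrr.
Qed.

Lemma bhom0r s : b U s 0 = 0.
Proof.
have := bhom_linr b 1 s (0 : msec G U) 0; rewrite scaler0 addr0 scale1r.
by move/(congr1 (fun z => z - b U s 0)); rewrite addrK subrr.
Qed.

Lemma bhomZl a s t : b U (a *: s) t = a *: b U s t.
Proof. by rewrite -[a *: s]addr0 bhom_linl bhom0l addr0. Qed.

Lemma bhomZr a s t : b U s (a *: t) = a *: b U s t.
Proof. by rewrite -[a *: t]addr0 bhom_linr bhom0r addr0. Qed.

End Bilin.

(* Rank one enters as the proportionality of all sections, perfectness of the
   form as the decomposition of 1. *)
Lemma is_tensor_form (X : ringedSpace) (L : modSheaf X)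
    (b : bilinHom L L (structSheaf X)) (I : finType)
    (k : I -> rsec (whole X)) (x : I -> msec L (whole X)) :
    (forall U (u v w : msec L U), (b U u v : rsec U) *: w = (b U w v : rsec U) *: u) ->
    (forall U (u v w : msec L U), (b U u v : rsec U) *: w = (b U u w : rsec U) *: v) ->
    \sum_i k i * (b _ (x i) (x i) : rsec (whole X)) = 1 ->
  is_tensor L L (structSheaf X).
Proof.
move=> propl propr sum1; exists b => H c.
pose y U i := mres (@sub_whole X U) (x i).
have b1 U : \sum_i gres U (k i) * (b U (y U i) (y U i) : rsec U) = 1.
  rewrite -(rmorph1 (gres U)) -sum1 rmorph_sum; apply: eq_bigr => i _.
  by rewrite rmorphM /= bhom_res.
(* The factorization of [c] must send 1 to [z], by the decomposition of 1; this gives its existence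
   and its uniqueness. *)
pose z := \sum_i k i *: c _ (x i) (x i).
have zE U : mres (@sub_whole X U) z
    = \sum_i gres U (k i) *: c U (y U i) (y U i).
  rewrite /z; elim/big_rec2: _ => [|i s t _ IH].
    by rewrite -(scale0r 0) mresZ rmorph0 !scale0r.
  by rewrite mresD mresZ IH bhom_res.
exists (scale_hom z); split=> [U s t|psi psiP U f].
  rewrite scale_homE zE scaler_sumr.
  rewrite -[RHS]scale1r -(b1 U) scaler_suml; apply: eq_bigr => i _.
  rewrite scalerA mulrC -!scalerA; congr (_ *: _).
  (* With [y] for [y U i], proportionality is used once in each argument: [b(s, t) c(y, y) = b(y, t)
     c(s, y) = b(y, y) c(s, t)]. *)
  by rewrite -bhomZl propl bhomZl -bhomZr propr bhomZr.
have psi1 : psi U 1 = mres (@sub_whole X U) z.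
  rewrite zE -(b1 U) linear_sum; apply: eq_bigr => i _.
  by rewrite -psiP -linearZ.
by rewrite scale_homE -psi1 -linearZ /= [_ *: _]mulr1.
Qed.

(** * Nilpotent two by two matrices *)

Section TwoByTwo.
Variable A : comPzRingType.
Implicit Types (M : 'M[A]_2) (v w : 'cV[A]_2).

Lemma sum2 (V : nmodType) (F : 'I_2 -> V) : \sum_i F i = F 0 + F 1.
Proof. by rewrite !big_ord_recl big_ord0 addr0; congr (F _ + F _); apply: val_inj. Qed.

Lemma ord2_ind (P : 'I_2 -> Prop) : P 0 -> P 1 -> forall i, P i.
Proof.
by move=> P0 P1 [[|[|//]] hi]; [move: P0|move: P1]; congr P; apply: val_inj.
Qed.

Lemma mulmx2E m n (M : 'M[A]_(m, 2)) (M' : 'M[A]_(2, n)) i j :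
  (M *m M') i j = M i 0 * M' 0 j + M i 1 * M' 1 j.
Proof. by rewrite mxE sum2. Qed.

Definition col2 (x y : A) : 'cV[A]_2 := \col_i (if i == 0 then x else y).

Lemma col2_eq v x y : v 0 0 = x -> v 1 0 = y -> v = col2 x y.
Proof.
by move=> vx vy; apply/matrixP => i j; rewrite ord1 mxE; elim/ord2_ind: i.
Qed.

Variable N : 'M[A]_2.
Hypothesis N11 : N 1 1 = - N 0 0.

Lemma ker2P v : N *m v = 0 <->
  N 0 0 * v 0 0 + N 0 1 * v 1 0 = 0 /\ N 1 0 * v 0 0 = N 0 0 * v 1 0.
Proof.
split=> [/matrixP Nv|[e0 e1]].
  split; first by have := Nv 0 0; rewrite mulmx2E mxE.
  by have := Nv 1 0; rewrite mulmx2E mxE N11 mulNr => /eqP; rewrite subr_eq0 => /eqP.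
apply/matrixP => i j; rewrite ord1 mulmx2E mxE; elim/ord2_ind: i => //.
by rewrite N11 mulNr e1 subrr.
Qed.

Hypothesis detN : N 0 0 ^+ 2 + N 0 1 * N 1 0 = 0.

(** Trace and determinant vanish, so [N] squares to zero and its columns lie in its kernel. *)
Lemma ker2_col0 : N *m col2 (N 0 0) (N 1 0) = 0.
Proof. by apply/ker2P; rewrite !mxE /=; split; [rewrite -detN|]; ring. Qed.

Lemma ker2_col1 : N *m col2 (N 0 1) (- N 0 0) = 0.
Proof.
apply/ker2P; rewrite !mxE /=; split; first by ring.
by apply/eqP; rewrite -subr_eq0 -detN; apply/eqP; ring.
Qed.

Variables r s : A.
Hypothesis unimod : r * N 0 1 + s * N 1 0 = 1.

(* If v = N *m v' then this is the determinant of (v', w). *)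
Definition nil_form v w : A := s * (v 1 0 * w 1 0) - r * (v 0 0 * w 0 0).

(** For the standard basis vector [e] the form at [N e], [N e] is the determinant of [e] and [N e],
    hence an off-diagonal entry of [N] up to sign. *)
Lemma nil_form_col0 :
  nil_form (col2 (N 0 0) (N 1 0)) (col2 (N 0 0) (N 1 0)) = N 1 0.
Proof.
rewrite -[RHS]mul1r -unimod /nil_form !mxE /=.
by apply/eqP; rewrite -subr_eq0 -(mulr0 (- r)) -detN; apply/eqP; ring.
Qed.

Lemma nil_form_col1 :
  nil_form (col2 (N 0 1) (- N 0 0)) (col2 (N 0 1) (- N 0 0)) = - N 0 1.
Proof.
rewrite -[RHS]mul1r -unimod /nil_form !mxE /=.
by apply/eqP; rewrite -subr_eq0 -(mulr0 s) -detN; apply/eqP; ring.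
Qed.

(** The kernel has rank one: the determinant of [v] and [w] is killed by [N 0 1] and by [N 1 0],
    which generate the unit ideal. *)
Lemma ker2_det0 v w : N *m v = 0 -> N *m w = 0 -> v 0 0 * w 1 0 = v 1 0 * w 0 0.
Proof.
move=> /ker2P[v0 v1] /ker2P[w0 w1].
have {}v0 : N 0 1 * v 1 0 = - (N 0 0 * v 0 0) by apply/eqP; rewrite -addr_eq0 addrC v0.
have {}w0 : N 0 1 * w 1 0 = - (N 0 0 * w 0 0) by apply/eqP; rewrite -addr_eq0 addrC w0.
rewrite -[LHS]mul1r -[RHS]mul1r -unimod.
transitivity (r * v 0 0 * (N 0 1 * w 1 0) + s * w 1 0 * (N 1 0 * v 0 0)).
  by ring.
rewrite w0 v1.
transitivity (r * w 0 0 * (N 0 1 * v 1 0) + s * v 1 0 * (N 1 0 * w 0 0)).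
  by rewrite v0 w1; ring.
by ring.
Qed.

Lemma nil_form_prop u v w : N *m u = 0 -> N *m v = 0 -> N *m w = 0 ->
  nil_form u v *: w = nil_form w v *: u.
Proof.
move=> Ku Kv Kw; have e := ker2_det0 Ku Kw.
have p0 : nil_form u v * w 0 0 = nil_form w v * u 0 0.
  by rewrite /nil_form; ring: e.
have p1 : nil_form u v * w 1 0 = nil_form w v * u 1 0.
  by rewrite /nil_form; ring: e.
by apply/matrixP => i j; rewrite ord1 !mxE; elim/ord2_ind: i.
Qed.

Lemma nil_formC u v : nil_form u v = nil_form v u.
Proof. by rewrite /nil_form [u 1 0 * _]mulrC [u 0 0 * _]mulrC. Qed.

(** Local generator of the kernel: where an off-diagonal entry is a unit, the column of [N]
    containing it spans, and the coefficient is read off at that entry. *)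
Lemma ker2_gen_c i v : i * N 1 0 = 1 -> N *m v = 0 ->
  v = (i * v 1 0) *: col2 (N 0 0) (N 1 0).
Proof.
move=> iN /ker2P[_ v1]; apply/matrixP => k j; rewrite ord1 !mxE.
elim/ord2_ind: k => /=; last by ring: iN.
by rewrite -mulrA [v 1 0 * _]mulrC -v1 mulrA iN mul1r.
Qed.

Lemma ker2_gen_b i v : i * N 0 1 = 1 -> N *m v = 0 ->
  v = (i * v 0 0) *: col2 (N 0 1) (- N 0 0).
Proof.
move=> iN /ker2P[v0 _]; apply/matrixP => k j; rewrite ord1 !mxE.
elim/ord2_ind: k => /=; first by ring: iN.
transitivity (i * (N 0 1 * v 1 0)); first by rewrite mulrA iN mul1r.
have -> : N 0 1 * v 1 0 = - (N 0 0 * v 0 0).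
  by apply/eqP; rewrite -addr_eq0 addrC v0.
by ring.
Qed.

End TwoByTwo.

Lemma map_col2 (A B : comPzRingType) (f : {rmorphism A -> B}) x y :
  map_mx f (col2 x y) = col2 (f x) (f y).
Proof. by apply: col2_eq; rewrite !mxE. Qed.

(** The matrix [H] with rows [(0, s)] and [(r, 0)] is a contracting homotopy: [N H + H N] is the
    identity. The preimage of [v] is [H v]. *)
Lemma ker2_image (A : comPzRingType) (N : 'M[A]_2) (r s : A) (v : 'cV[A]_2) :
    N 1 1 = - N 0 0 -> r * N 0 1 + s * N 1 0 = 1 -> N *m v = 0 ->
  v = N *m col2 (s * v 1 0) (r * v 0 0).
Proof.
move=> N11 unimod /(ker2P N11)[v0 v1].
have {}v0 : N 0 1 * v 1 0 = - (N 0 0 * v 0 0).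
  by apply/eqP; rewrite -addr_eq0 addrC v0.
apply/matrixP => i j; rewrite ord1 mulmx2E !mxE; elim/ord2_ind: i => /=.
  rewrite -[LHS]mul1r -unimod.
  transitivity (r * N 0 1 * v 0 0 + s * (N 1 0 * v 0 0)); first by ring.
  by rewrite v1; ring.
rewrite -[LHS]mul1r -unimod N11.
transitivity (r * (N 0 1 * v 1 0) + s * N 1 0 * v 1 0); first by ring.
by rewrite v0; ring.
Qed.

(** The commutator has only its upper right entry, so the product involves [Z] only through
    [Z 1 0]. *)
Lemma triangular2_commutator (A : comPzRingType) (T T' Z : 'M[A]_2) :
    T 1 0 = 0 -> T' 1 0 = 0 -> Z 1 0 = 0 ->
  let S := T *m T' - T' *m T in S *m Z *m S = 0.
Proof.
move=> T10 T10' Z10 S.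
have SE i j : S i j = T i 0 * T' 0 j + T i 1 * T' 1 j
    - (T' i 0 * T 0 j + T' i 1 * T 1 j) by rewrite !mxE !sum2.
have S00 : S 0 0 = 0 by rewrite SE T10 T10'; ring.
have S10 : S 1 0 = 0 by rewrite SE T10 T10'; ring.
have S11 : S 1 1 = 0 by rewrite SE T10 T10'; ring.
apply/matrixP => i j; rewrite !mulmx2E [RHS]mxE Z10.
by elim/ord2_ind: i; elim/ord2_ind: j; rewrite ?S00 ?S10 ?S11; ring.
Qed.

Section Triangularization.
Variables (A : comPzRingType).

Definition mx22 (a b c d : A) : 'M[A]_2 :=
  \matrix_(i, j) if i == 0 then if j == 0 then a else b
                 else if j == 0 then c else d.

(** A unimodular [v] is completed to a matrix of determinant 1 with first column [v]. The second row
    of its inverse annihilates [v], hence also [M *m v]. *)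
Lemma triangularize_eigenvector (v : 'cV[A]_2) (u : 'rV[A]_2) :
    u *m v = 1%:M ->
  exists P Pinv : 'M[A]_2,
    [/\ P *m Pinv = 1%:M, Pinv *m P = 1%:M
      & forall M f, M *m v = f *: v -> upper_triangular (P *m M *m Pinv)].
Proof.
move=> /matrixP/(_ 0 0); rewrite mulmx2E mxE /= => uv.
exists (mx22 (u 0 0) (u 0 1) (- v 1 0) (v 0 0)).
exists (mx22 (v 0 0) (- u 0 1) (v 1 0) (u 0 0)); split=> [||M f Mv].
- apply/matrixP => i j; rewrite mulmx2E !mxE.
  by elim/ord2_ind: i; elim/ord2_ind: j => /=; rewrite -?uv; ring.
- apply/matrixP => i j; rewrite mulmx2E !mxE.
  by elim/ord2_ind: i; elim/ord2_ind: j => /=; rewrite -?uv; ring.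
have e0 : M 0 0 * v 0 0 + M 0 1 * v 1 0 = f * v 0 0.
  by rewrite -mulmx2E Mv mxE.
have e1 : M 1 0 * v 0 0 + M 1 1 * v 1 0 = f * v 1 0.
  by rewrite -mulmx2E Mv mxE.
move=> i j; elim/ord2_ind: i => //; elim/ord2_ind: j => // _.
rewrite -mulmxA mulmx2E !(mulmx2E M) !mxE /= e0 e1; ring.
Qed.

End Triangularization.

(** * The kernel of a nilpotent matrix as an invertible sheaf with trivial square *)

Section NilpotentKernel.
Variables (X : ringedSpace) (N : 'M[rsec (whole X)]_2).
Variables r s : rsec (whole X).
Hypothesis N11 : N 1 1 = - N 0 0.
Hypothesis detN : N 0 0 ^+ 2 + N 0 1 * N 1 0 = 0.
Hypothesis unimod : r * N 0 1 + s * N 1 0 = 1.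
Implicit Types U V : opens X.

Let NU U := map_mx (gres U) N.

Fact gres_N11 U : NU U 1 1 = - NU U 0 0.
Proof. by rewrite !mxE N11 rmorphN. Qed.

Fact gres_detN U : NU U 0 0 ^+ 2 + NU U 0 1 * NU U 1 0 = 0.
Proof. by rewrite !mxE -(rmorph0 (gres U)) -detN rmorphD rmorphM rmorphXn. Qed.

Fact gres_unimod U : gres U r * NU U 0 1 + gres U s * NU U 1 0 = 1.
Proof. by rewrite !mxE -(rmorph1 (gres U)) -unimod rmorphD !rmorphM. Qed.

Let formU U (v w : kersec N U) : (rsec U)^o := nil_form (gres U r) (gres U s) v w.

Definition nil_bilin : bilinHom (kerSheaf N) (kerSheaf N) (structSheaf X).
refine (@BilinHom X (kerSheaf N) (kerSheaf N) (structSheaf X) formU _ _ _).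
- move=> U a u v w.
  by rewrite /formU /nil_form /= !mxE /GRing.scale /=; ring.
- move=> U a u v w.
  by rewrite /formU /nil_form /= !mxE /GRing.scale /=; ring.
- move=> U V h u v.
  by rewrite /formU /nil_form /= !mxE rmorphB !rmorphM !gresE.
Defined.

Fact gres_col0 U : col2 (NU U 0 0) (NU U 1 0) \in @in_kernel _ _ _ N U.
Proof. by apply/eqP/ker2_col0; [apply: gres_N11 | apply: gres_detN]. Qed.

Fact gres_col1 U : col2 (NU U 0 1) (- NU U 0 0) \in @in_kernel _ _ _ N U.
Proof. by apply/eqP/ker2_col1; [apply: gres_N11 | apply: gres_detN]. Qed.

Let ker0 U : msec (kerSheaf N) U := Kersec (gres_col0 U).
Let ker1 U : msec (kerSheaf N) U := Kersec (gres_col1 U).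

Fact res_ker0 U V (h : V `<=` U) : mres h (ker0 U) = ker0 V.
Proof. by apply: val_inj; rewrite /= map_col2 !mxE !gresE. Qed.

Fact res_ker1 U V (h : V `<=` U) : mres h (ker1 U) = ker1 V.
Proof. by apply: val_inj; rewrite /= map_col2 !mxE rmorphN !gresE. Qed.

Lemma kernel_sheaf_tensor :
  is_tensor (kerSheaf N) (kerSheaf N) (structSheaf X).
Proof.
(* The form takes the values [N 1 0] and [- N 0 1] at the two columns, so the weights [s] and [- r]
   recover [unimod]. *)
apply: (@is_tensor_form _ _ nil_bilin bool (fun i => if i then s else - r)
  (fun i => if i then ker0 (whole X) else ker1 (whole X))).
- move=> U u v w; apply: val_inj => /=.
  by apply: (nil_form_prop (gres_N11 U) (gres_unimod U)); apply: kersec_eq.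
- move=> U u v w; apply: val_inj => /=.
  rewrite /formU (nil_formC _ _ u v) (nil_formC _ _ u w).
  by apply: (nil_form_prop (gres_N11 U) (gres_unimod U)); apply: kersec_eq.
rewrite big_bool /= /formU /= nil_form_col0 ?nil_form_col1 //;
  try by [apply: gres_N11 | apply: gres_detN | apply: gres_unimod].
by rewrite mulrNN addrC /NU map_gres_whole unimod.
Qed.

Lemma kernel_sheaf_invertible :
    (forall x : X, exists U, U x /\
       exists i, i * gres U (N 0 1) = 1 \/ i * gres U (N 1 0) = 1) ->
  invertible_sheaf (kerSheaf N).
Proof.
move=> cov x; have [U [Ux [i iN]]] := cov x; exists U; split=> //.
case: iN => iN.
- apply: (iso_on_generator (x := ker1 U)) => V h v; rewrite res_ker1.
  have iV : rres h i * NU V 0 1 = 1.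
    by rewrite mxE -(gresE h) -rmorphM iN rmorph1.
  have Kv := kersec_eq v; have E := ker2_gen_b (gres_N11 V) iV Kv.
  exists (rres h i * v 0 0); split=> [|f vf]; first by apply: val_inj.
  by rewrite vf /= !mxE /= mulrCA -(gresE h) -rmorphM iN rmorph1 mulr1.
- apply: (iso_on_generator (x := ker0 U)) => V h v; rewrite res_ker0.
  have iV : rres h i * NU V 1 0 = 1.
    by rewrite mxE -(gresE h) -rmorphM iN rmorph1.
  have Kv := kersec_eq v; have E := ker2_gen_c (gres_N11 V) iV Kv.
  exists (rres h i * v 1 0); split=> [|f vf]; first by apply: val_inj.
  by rewrite vf /= !mxE /= mulrCA -(gresE h) -rmorphM iN rmorph1 mulr1.
Qed.

Lemma kernel_unimodular_generator : iso (kerSheaf N) (structSheaf X) ->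
  exists (v : 'cV[rsec (whole X)]_2) (u : 'rV_2),
    [/\ N *m v = 0, u *m v = 1%:M
      & forall w : 'cV_2, N *m w = 0 -> exists f, w = f *: v].
Proof.
move=> /iso_structSheaf_generator[v gen].
have [f0 e0] := gen (ker0 (whole X)); have [f1 e1] := gen (ker1 (whole X)).
have {}e0 := congr1 val e0; have {}e1 := congr1 val e1.
rewrite /= /NU map_gres_whole in e0; rewrite /= /NU map_gres_whole in e1.
(* The columns of [N] are [f0 *: v] and [f1 *: v], so [unimod] reads [(s * f0 ^+ 2 - r * f1 ^+ 2) *
   nil_form r s v v = 1]. As [nil_form r s v v] is linear in the coordinates of its second argument,
   this yields the row. *)
exists v, (\row_j (if j == 0 then (r * f1 ^+ 2 - s * f0 ^+ 2) * r * (v : 'cV_2) 0 0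
  else (s * f0 ^+ 2 - r * f1 ^+ 2) * s * (v : 'cV_2) 1 0)).
split=> [||w Nw].
- by have := kersec_eq v; rewrite map_gres_whole.
- apply/matrixP => i j; rewrite !ord1 mulmx2E !mxE /=.
  have E0 : N 1 0 = f0 ^+ 2 * nil_form r s v v.
    by rewrite -(nil_form_col0 detN unimod) e0 /nil_form !mxE; ring.
  have E1 : N 0 1 = - (f1 ^+ 2 * nil_form r s v v).
    rewrite -[LHS]opprK -(nil_form_col1 detN unimod) e1.
    by rewrite /nil_form !mxE; ring.
  by rewrite -unimod E0 E1 /nil_form; ring.
have Kw : w \in @in_kernel _ _ _ N (whole X).
  by rewrite unfold_in map_gres_whole; apply/eqP.
by have [f /(congr1 val) /= e] := gen (Kersec Kw); exists f.
Qed.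

End NilpotentKernel.

(** * Representations with Borel mold *)

Section CommutationModPrime.
Variables (R : comPzRingType) (p : spec R).

(** The maximal ideal of the local ring; congruences modulo it stand for equalities over the residue
    field. *)
Definition vanishing (x : loc p) : Prop := exists a d, a \in p /\ x = mkloc a d.

Lemma vanishing_cst a : a \in p -> vanishing (loc_cst p a).
Proof. by exists a, (denom1 p). Qed.

Lemma vanishing0 : vanishing 0.
Proof. exact/vanishing_cst/pideal0. Qed.

Lemma vanishingD x y : vanishing x -> vanishing y -> vanishing (x + y).
Proof.
move=> [a [d [ap ->]]] [b [e [bp ->]]]; rewrite [_ + _]loc_addE.
eexists _, _; split; last by [].
by apply: pidealD; rewrite mulrC; apply: pidealM.
Qed.

Lemma vanishingM x y : vanishing y -> vanishing (x * y).
Proof.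
have [a [d ->]] := mkloc_surj x; move=> [b [e [bp ->]]].
rewrite [_ * _]loc_mulE.
by eexists _, _; split; last by []; apply: pidealM.
Qed.

Lemma vanishing1 : ~ vanishing 1.
Proof.
move=> [a [d [ap /mklocP[u up /= e]]]].
have : u * sval d \in p.
  by move: e; rewrite mul1r mulr1 => ->; apply: pidealM.
by move=> /pideal_prime/orP[]; apply/negP => //; apply: (svalP d).
Qed.

Variable n : nat.
Implicit Types M K : 'M[loc p]_n.

Definition vanishing_mx M : Prop := forall i j, vanishing (M i j).

Lemma vanishing_mxD M K :
  vanishing_mx M -> vanishing_mx K -> vanishing_mx (M + K).
Proof. by move=> vM vK i j; rewrite mxE; apply: vanishingD. Qed.

Lemma vanishing_mulmx M K : vanishing_mx K -> vanishing_mx (M *m K).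
Proof.
move=> vK i j; rewrite mxE; elim/big_rec: _ => [|k x _ vx].
  exact: vanishing0.
by apply: vanishingD => //; apply: vanishingM.
Qed.

Lemma vanishing_mulmxr M K : vanishing_mx M -> vanishing_mx (M *m K).
Proof.
move=> vM i j; rewrite mxE; elim/big_rec: _ => [|k x _ vx].
  exact: vanishing0.
by apply: vanishingD => //; rewrite mulrC; apply: vanishingM.
Qed.

Definition commp M K : Prop := vanishing_mx (M *m K - K *m M).

Lemma commp_sym M K : commp M K -> commp K M.
Proof.
move=> c; rewrite /commp -opprB -[- _]mul1mx mulmxN -mulNmx.
exact: vanishing_mulmx.
Qed.

Lemma commp1 K : commp 1%:M K.
Proof. by move=> i j; rewrite mul1mx mulmx1 subrr mxE; apply: vanishing0. Qed.

Lemma commpD M M' K : commp M K -> commp M' K -> commp (M + M') K.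
Proof.
move=> c c'; rewrite /commp mulmxDl mulmxDr opprD addrACA.
exact: vanishing_mxD.
Qed.

(** The commutator with [K] is a derivation: [[M M', K] = M [M', K] + [M, K] M']. *)
Lemma commpM M M' K : commp M K -> commp M' K -> commp (M *m M') K.
Proof.
move=> c c'; have -> : commp (M *m M') K =
    vanishing_mx (M *m (M' *m K - K *m M') + (M *m K - K *m M) *m M').
  by rewrite /commp mulmxBr mulmxBl !mulmxA subrKA.
by apply: vanishing_mxD; [apply: vanishing_mulmx | apply: vanishing_mulmxr].
Qed.

Lemma commpZ a M K : commp M K -> commp (a *: M) K.
Proof.
move=> c; rewrite -mul_scalar_mx; apply: commpM => //.
by move=> i j; rewrite scalar_mxC subrr mxE; apply: vanishing0.
Qed.

(** For the inverse, [[M', K] = M' [K, M] M']. *)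
Lemma commp_inv M M' K : M *m M' = 1%:M -> M' *m M = 1%:M ->
  commp M K -> commp M' K.
Proof.
move=> MM' M'M /commp_sym c.
have -> : commp M' K = vanishing_mx (M' *m (K *m M - M *m K) *m M').
  rewrite /commp mulmxBr mulmxBl !mulmxA M'M mul1mx.
  by rewrite -[_ *m M *m M']mulmxA MM' mulmx1.
by apply: vanishing_mulmxr; apply: vanishing_mulmx.
Qed.

Definition germ_mx (U : opens (spec R)) (Up : U p) (M : 'M[regsec U]_n) :
  'M[loc p]_n := map_mx (germ Up) M.

Lemma germ_mx_irr (U : opens (spec R)) (Up Up' : U p)
  (M : 'M[regsec U]_n) :
  germ_mx Up M = germ_mx Up' M.
Proof. by congr (germ_mx _ M); apply: Prop_irrelevance. Qed.

Lemma germ_mx_res (U V : opens (spec R)) (h : V `<=` U) (Vp : V p)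
  (M : 'M[regsec U]_n) :
  germ_mx Vp (map_mx (reg_res h) M) = germ_mx (h _ Vp) M.
Proof. by apply/matrixP => i j; rewrite !mxE. Qed.

Variable S : set 'M[loc p]_n.

(** [S] consists of germs, so that it may come from sections over a small open set; the condition is
    void when [U] misses [p]. A generated subsheaf lies in this one as soon as its generators do. *)
Definition centr_sec (U : opens (spec R)) : set 'M[regsec U]_n :=
  [set M | forall Up : U p, forall K, S K -> commp (germ_mx Up M) K].
Arguments centr_sec : clear implicits.

Fact centr1 U : centr_sec U 1%:M.
Proof. by move=> Up K _; rewrite /germ_mx map_mx1; apply: commp1. Qed.

Fact centrD U A B : centr_sec U A -> centr_sec U B -> centr_sec U (A + B).
Proof.
move=> cA cB Up K SK; rewrite /germ_mx map_mxD.
by apply: commpD; [apply: cA | apply: cB].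
Qed.

Fact centrZ U a A : centr_sec U A -> centr_sec U (a *: A).
Proof. by move=> cA Up K SK; rewrite /germ_mx map_mxZ; apply/commpZ/cA. Qed.

Fact centrM U A B : centr_sec U A -> centr_sec U B -> centr_sec U (A *m B).
Proof.
move=> cA cB Up K SK; rewrite /germ_mx map_mxM.
by apply: commpM; [apply: cA | apply: cB].
Qed.

Fact centr_res (U V : opens (spec R)) (h : V `<=` U) A :
  centr_sec U A -> centr_sec V (map_mx (reg_res h) A).
Proof. by move=> cA Vp K SK; rewrite germ_mx_res; apply: cA. Qed.

Fact centr_loc (U : opens (spec R)) (A : 'M[regsec U]_n) :
  (forall x, U x -> exists (V : opens (spec R)) (h : V `<=` U),
     V x /\ centr_sec V (map_mx (reg_res h) A)) -> centr_sec U A.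
Proof.
move=> locA Up K SK; have [V [h [Vp /(_ Vp K SK)]]] := locA p Up.
by rewrite germ_mx_res (germ_mx_irr _ Up).
Qed.

Definition centralizer : algSubsheaf (SpecR R) n :=
  @AlgSubsheaf (SpecR R) n centr_sec centr1 centrD centrZ centrM centr_res
    centr_loc.

End CommutationModPrime.

Section RepresentationGerms.
Variables (Gamma : groupType) (R : comPzRingType) (n : nat).
Variable rho : representation Gamma R n.

Lemma rep1 : rho 1%g = 1%:M.
Proof.
have [Q [_ QM]] := rep_GL rho 1%g.
by rewrite -[LHS]mul1mx -QM -mulmxA -repM mulg1 QM.
Qed.

Lemma repV g : rho g *m rho g^-1%g = 1%:M /\ rho g^-1%g *m rho g = 1%:M.
Proof. by rewrite -!repM mulgV mulVg rep1. Qed.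

Definition rep_germ (p : spec R) (g : Gamma) : 'M[loc p]_n :=
  map_mx (loc_cst p) (rho g).

Lemma rep_mold_rep (U : opens (spec R)) g :
  rep_mold rho U (map_mx (reg_cst U) (rho g)).
Proof.
move=> A SA; have := SA _ (ex_intro _ g erefl).
move=> /(asec_res _ _ _ _ _ (@sub_whole (SpecR R) U)).
by congr (A U _); apply/matrixP => i j; rewrite !mxE; apply: regsecP.
Qed.

(** The elements commuting modulo [p] with a fixed matrix form a subgroup. This is applied against
    [g0] and [h0], then against an arbitrary element. *)
Lemma commp_group (p : spec R) g0 h0 :
    (forall H : {pred Gamma}, group_closed H -> g0 \in H -> h0 \in H ->
       forall x, x \in H) ->
    commp (rep_germ p g0) (rep_germ p h0) ->
  forall g h, commp (rep_germ p g) (rep_germ p h).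
Proof.
move=> gen c.
have ind K : commp (rep_germ p g0) K -> commp (rep_germ p h0) K ->
    forall x, commp (rep_germ p x) K.
  move=> cg ch x; apply/asboolP.
  apply: (gen (fun x => `[< commp (rep_germ p x) K >])).
  - split=> [|x1 x2 /asboolP c1 /asboolP c2]; apply/asboolP.
      by rewrite /rep_germ rep1 map_mx1; apply: commp1.
    have [e1 e2] := repV x2.
    rewrite /rep_germ repM map_mxM; apply: (commpM c1).
    by apply: (commp_inv _ _ c2); rewrite -map_mxM ?e1 ?e2 map_mx1.
  - exact/asboolP.
  - exact/asboolP.
have refl x : commp (rep_germ p x) (rep_germ p x).
  by move=> i j; rewrite subrr mxE; apply: vanishing0.
move=> g h; apply: (ind (rep_germ p h)).
  exact: (commp_sym (ind _ (refl g0) (commp_sym c) h)).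
exact: (commp_sym (ind _ c (refl h0) h)).
Qed.

(** Centralizers are used twice: [K] lies in that of each [rep_germ p g], so every generator, and
    with it [M], lies in that of [K]. *)
Lemma commp_rep_mold (p : spec R) :
    (forall g h, commp (rep_germ p g) (rep_germ p h)) ->
  forall (U : opens (spec R)) (Up : U p) M K,
    rep_mold rho U M -> rep_mold rho U K -> commp (germ_mx Up M) (germ_mx Up K).
Proof.
move=> c U Up M K gM gK.
have cst (V : opens (spec R)) (Vp : V p) g :
    germ_mx Vp (map_mx (reg_cst V) (rho g)) = rep_germ p g.
  by apply/matrixP => i j; rewrite !mxE.
apply: (gM (centralizer [set germ_mx Up K])) => [_ [g ->] Wp _ ->|//].
rewrite cst; apply: commp_sym.
apply: (gK (centralizer [set rep_germ p g])) => [_ [h ->] Wp' _ ->|//].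
by rewrite cst.
Qed.

End RepresentationGerms.

Section BorelMold.
Variables (Gamma : groupType) (R : comPzRingType).
Variable rho : representation Gamma R 2.
Hypothesis rhoB : with_Borel_mold rho.

(** The local equivalence is carried to the stalk at [p]. The sections [M] and [K] become two
    triangular matrix units that do not commute. *)
Lemma Borel_germ (p : spec R) : exists (U : opens (spec R)) (Up : U p)
    (P Q : 'M[loc p]_2) (M K : 'M[regsec U]_2),
  [/\ P *m Q = 1%:M, Q *m P = 1%:M,
      forall g, upper_triangular (Q *m rep_germ rho p g *m P),
      rep_mold rho U M /\ Q *m germ_mx Up M *m P = delta_mx 0 0
    & rep_mold rho U K /\ Q *m germ_mx Up K *m P = delta_mx 0 1].
Proof.
have [_ /(_ p)[U [Up [P [Q [PQ QP conj]]]]]] := rhoB.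
have {}conj := conj U (fun _ => id).
have resE (M : 'M[regsec U]_2) :
    map_mx (rres (r := SpecR R) (U := U) (V := U) (fun _ => id)) M = M.
  by apply/matrixP => i j; rewrite mxE; apply: regsecP.
rewrite !resE in conj.
have ut : forall k, BorelSheaf (SpecR R) 2 U (delta_mx 0 k).
  move=> k i j; rewrite mxE; elim/ord2_ind: i => //=.
have := ut 0; rewrite -conj => -[M gM eM].
have := ut 1; rewrite -conj => -[K gK eK].
have germD i j : germ_mx (Up : U p) (delta_mx i j) = delta_mx i j.
  by rewrite /germ_mx map_delta_mx.
exists U, Up, (germ_mx Up P), (germ_mx Up Q), M, K; split.
- by rewrite /germ_mx -map_mxM PQ map_mx1.
- by rewrite /germ_mx -map_mxM QP map_mx1.
- move=> g i j ji.
  have /(_ i j ji) e : upper_triangular (Q *m map_mx (reg_cst U) (rho g) *m P).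
    suff : BorelSheaf (SpecR R) 2 U (Q *m map_mx (reg_cst U) (rho g) *m P) by [].
    by rewrite -conj; exists (map_mx (reg_cst U) (rho g)) => //;
      apply: rep_mold_rep.
  have -> : rep_germ rho p g = germ_mx Up (map_mx (reg_cst U) (rho g)).
    by apply/matrixP => k l; rewrite !mxE.
  by rewrite /germ_mx -!map_mxM mxE e rmorph0.
- by split=> //; rewrite /germ_mx -!map_mxM eM map_delta_mx.
- by split=> //; rewrite /germ_mx -!map_mxM eK map_delta_mx.
Qed.

(** The commutator of [delta_mx 0 0] and [delta_mx 0 1] has an entry 1, which is not in the maximal
    ideal. *)
Lemma Borel_not_comm (p : spec R) :
  ~ forall g h, commp (rep_germ rho p g) (rep_germ rho p h).
Proof.
have [U [Up [P [Q [M [K [PQ QP _ [gM eM] [gK eK]]]]]]]] := Borel_germ p.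
move=> /commp_rep_mold/(_ U Up M K gM gK) c.
have /(_ 0 1) : vanishing_mx (Q *m (germ_mx Up M *m germ_mx Up K
    - germ_mx Up K *m germ_mx Up M) *m P).
  by apply: vanishing_mulmxr; apply: vanishing_mulmx.
have mulQP (M1 M2 : 'M_2) :
    Q *m (M1 *m M2) *m P = (Q *m M1 *m P) *m (Q *m M2 *m P).
  by rewrite !mulmxA -[_ *m P *m Q]mulmxA PQ mulmx1.
rewrite mulmxBr mulmxBl !mulQP eM eK !mul_delta_mx_cond /= mulr0n subr0 mxE.
exact: vanishing1.
Qed.

(** Vanishing is checked at each prime, where conjugation makes all three matrices triangular. *)
Lemma Borel_commutator g h x :
  let N := rho g *m rho h - rho h *m rho g in N *m rho x *m N = 0.
Proof.
move=> N; apply/matrixP => i j; rewrite [RHS]mxE; apply: loc_cst_inj => p.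
have [U [Up [P [Q [M [K [PQ QP ut _ _]]]]]]] := Borel_germ p.
have mulQP (M1 M2 : 'M_2) :
    Q *m (M1 *m M2) *m P = (Q *m M1 *m P) *m (Q *m M2 *m P).
  by rewrite !mulmxA -[_ *m P *m Q]mulmxA PQ mulmx1.
suff : map_mx (loc_cst p) (N *m rho x *m N) = 0.
  by move=> /matrixP/(_ i j); rewrite !mxE.
pose T y := Q *m rep_germ rho p y *m P; pose S := T g *m T h - T h *m T g.
have SE : Q *m map_mx (loc_cst p) N *m P = S.
  by rewrite /S /T -!mulQP -mulmxBl -mulmxBr map_mxB !map_mxM.
have STS : S *m T x *m S = 0.
  by apply: triangular2_commutator; apply: (ut _ 1 0).
have : Q *m map_mx (loc_cst p) (N *m rho x *m N) *m P = 0.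
  by rewrite !map_mxM !mulQP SE.
move=> /(congr1 (fun Z => P *m Z *m Q)).
by rewrite mulmx0 mul0mx !mulmxA PQ mul1mx -mulmxA PQ mulmx1.
Qed.

End BorelMold.

(** * Descent of the kernel generator from global sections to the ring *)

Section GlobalSections.
Variable R : comPzRingType.
Local Notation cst := (reg_cst (whole (spec R))).

Lemma map_reg_cst_inj m n : injective (fun M : 'M[R]_(m, n) => map_mx cst M).
Proof.
move=> M M' /matrixP e; apply/matrixP => i j; apply: reg_cst_inj.
by have := e i j; rewrite !mxE.
Qed.

Lemma map_reg_cst_surj m n (M : 'M[regsec (whole (spec R))]_(m, n)) :
  exists M', M = map_mx cst M'.
Proof.
have [f fP] := choice (fun ij : 'I_m * 'I_n => reg_cst_surj (M ij.1 ij.2)).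
by exists (\matrix_(i, j) f (i, j)); apply/matrixP => i j; rewrite !mxE (fP (i, j)).
Qed.

Lemma nilpotent_kernel_generator (N : 'M[R]_2) (r s : R) :
    Pic_no_2torsion (SpecR R) ->
    N 1 1 = - N 0 0 -> N 0 0 ^+ 2 + N 0 1 * N 1 0 = 0 ->
    r * N 0 1 + s * N 1 0 = 1 ->
  exists (v : 'cV[R]_2) (u : 'rV[R]_2), [/\ N *m v = 0, u *m v = 1%:M
    & forall w : 'cV_2, N *m w = 0 -> exists f, w = f *: v].
Proof.
move=> PicR N11 detN unimod.
pose NX : 'M[rsec (whole (SpecR R))]_2 := map_mx cst N.
have NX11 : NX 1 1 = - NX 0 0 by rewrite !mxE N11 rmorphN.
have detNX : NX 0 0 ^+ 2 + NX 0 1 * NX 1 0 = 0.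
  by rewrite !mxE -rmorphXn -rmorphM -rmorphD /= detN rmorph0.
have unimodX : cst r * NX 0 1 + cst s * NX 1 0 = 1.
  by rewrite !mxE -!rmorphM -rmorphD /= unimod rmorph1.
have cov (p : SpecR R) : exists U : opens (SpecR R), U p /\
    exists i, i * gres U (NX 0 1) = 1 \/ i * gres U (NX 1 0) = 1.
  have gres_cst (U : opens (SpecR R)) a : gres U (cst a) = reg_cst U a.
    exact: regsecP.
  (* By [unimod] no prime contains both off-diagonal entries, and an entry is a unit on its own
     basic open set. *)
  have [bp|bp] := boolP (N 0 1 \in (p : spec R)).
    have cp : N 1 0 \notin (p : spec R).
      apply: contra (pideal1 p) => cp; rewrite -unimod.
      by apply: pidealD; apply: pidealM.
    exists (basic_open (N 1 0)); split=> //.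
    have [i iP] := basic_open_unit (N 1 0).
    by exists i; right; rewrite mxE gres_cst.
  exists (basic_open (N 0 1)); split=> //.
  have [i iP] := basic_open_unit (N 0 1).
  by exists i; left; rewrite mxE gres_cst.
have [v [u [Nv uv gen]]] := kernel_unimodular_generator NX11 detNX unimodX
  (PicR _ (kernel_sheaf_invertible NX11 detNX cov)
    (kernel_sheaf_tensor NX11 detNX unimodX)).
have [v' ev] := map_reg_cst_surj v; have [u' eu] := map_reg_cst_surj u.
exists v', u'; split=> [||w Nw].
- by apply: map_reg_cst_inj; rewrite /= map_mxM map_mx0 -ev.
- by apply: map_reg_cst_inj; rewrite /= map_mxM map_mx1 -ev -eu.
have [|f ef] := gen (map_mx cst w); first by rewrite -map_mxM Nw map_mx0.
have [f' ef'] := reg_cst_surj f; exists f'; apply: map_reg_cst_inj.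
by rewrite /= map_mxZ -ev ef ef'.
Qed.

End GlobalSections.

Theorem corollary4p9 (Gamma : groupType) (R : comPzRingType)
    (Gamma2 : generated_by_two Gamma)
    (PicR : Pic_no_2torsion (SpecR R))
    (rho : representation Gamma R 2) (rhoB : with_Borel_mold rho) :
  exists P Pinv : 'M[R]_2,
    [/\ P *m Pinv = 1%:M, Pinv *m P = 1%:M
      & forall gamma : Gamma, upper_triangular (P *m rho gamma *m Pinv)].
Proof.
have [g [h gen]] := Gamma2.
pose N := rho g *m rho h - rho h *m rho g.
have NrhoN x : N *m rho x *m N = 0 by apply: Borel_commutator.
have N11 : N 1 1 = - N 0 0 by rewrite !mxE !sum2; ring.
(* Taking the identity of the group for [x] gives [N *m N = 0], whose upper left entry is this
   expression. *)
have detN : N 0 0 ^+ 2 + N 0 1 * N 1 0 = 0.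
  have /matrixP/(_ 0 0) := NrhoN 1%g.
  by rewrite rep1 mulmx1 mulmx2E [RHS]mxE expr2.
have [r [s /esym unimod]] : exists r s, 1 = r * N 0 1 + s * N 1 0.
  apply: (ideal_full (ideal_pair _ _)) => p.
  have [bp|bp] := boolP (N 0 1 \in p); last first.
    by exists (N 0 1) => //; exists 1, 0; ring.
  have [cp|cp] := boolP (N 1 0 \in p); last first.
    by exists (N 1 0) => //; exists 0, 1; ring.
  (* If [p] contains both off-diagonal entries, it contains the square of [N 0 0], hence all of [N];
     the two generators then commute modulo [p], which [Borel_not_comm] excludes. *)
  have ap : N 0 0 \in p.
    suff : N 0 0 * N 0 0 \in p by move=> /pideal_prime/orP[].
    have -> : N 0 0 * N 0 0 = - N 1 0 * N 0 1.
      by apply/eqP; rewrite -subr_eq0 -detN; apply/eqP; ring.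
    exact: pidealM.
  have Np i j : N i j \in p.
    elim/ord2_ind: i; elim/ord2_ind: j => //.
    by rewrite N11 -mulN1r; apply: pidealM.
  case: (Borel_not_comm rhoB (p := p)); apply: (commp_group gen) => i j.
  rewrite /rep_germ -!map_mxM -map_mxB mxE.
  exact: vanishing_cst.
have [v [u [Nv uv genv]]] := nilpotent_kernel_generator PicR N11 detN unimod.
have [P [Pinv [PP' P'P triang]]] := triangularize_eigenvector uv.
exists P, Pinv; split=> // x.
(* Since [v] is in the image of [N], the relation [NrhoN] puts [rho x *m v] in the kernel; thus [v]
   is a common eigenvector. *)
have [|f ef] := genv (rho x *m v); last exact: triang ef.
by rewrite (ker2_image N11 unimod Nv) !mulmxA NrhoN mul0mx.
Qed.
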